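(* For every $\Delta$ there is a constant $C=C(\Delta)$, depending only on $\Delta$, such that the following holds. Let $\{G_i\}_{i\in I}$ be a family of finite simple graphs on $n$ vertices, indexed by a countable set $I$, and let $\mathcal{G}$ be a random graph with $P(\mathcal{G}=G_i)=p_i$, where $\sum_{i\in I}p_i=1$. Let $m(G_i)$ be the number of edges and $\Delta(G_i)$ the maximum degree of $G_i$, and suppose $m\ge 1$ is such that $m(G_i)\ge m$ and $\Delta(G_i)\le\Delta$ for all $i\in I$. Let $X=X(\mathcal{G})$ be the number of crossings in a uniformly random embedding of $\mathcal{G}$. For $i \in I$ let $\mu_i=E(X\mid\mathcal{G}=G_i)$, $\sigma_i^2=\mathrm{Var}(X\mid\mathcal{G}=G_i)$, and let $Z_i$ be a normal random variable with mean $\mu_i$ and variance $\sigma_i^2$. Then $$d_K\left(F_X,\ \sum_{i\in I}p_iF_{Z_i}\right)\le\frac{C}{\sqrt{m}}.$$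
   Context: Let $G=(V,E)$ be a finite simple graph with vertex set $V=[n]=\{1,\dots,n\}$. For a permutation $\pi\in S_n$, the embedding $G_\pi$ is the graph on $[n]$ in which $(\pi(v),\pi(w))$ is an edge if and only if $(v,w)\in E$. A crossing in $G_\pi$ is a quadruple $(a,b,c,d)$ of vertices with $(a,b),(c,d)\in E$ and $\pi(a)>\pi(c)>\pi(b)>\pi(d)$. A uniformly random embedding of $G$ is $G_\pi$ with $\pi$ uniformly random in $S_n$. For a random graph $\mathcal{G}$, the permutation $\pi$ is taken independent of $\mathcal{G}$, so conditionally on $\mathcal{G}=G_i$, $X$ is distributed as the number of crossings in a uniformly random embedding of $G_i$. $F_X$ denotes the cumulative distribution function of $X$. For cumulative distribution functions $F,H$, $d_K(F,H)=\sup_{x\in\mathbb{R}}|F(x)-H(x)|$. A normal random variable with variance $0$ is understood as the constant equal to its mean. *)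

(* Defs.v *)
From HB Require Import structures.
From mathcomp Require Import all_boot all_order all_fingroup all_algebra.

Set Implicit Arguments.
Unset Strict Implicit.
Unset Printing Implicit Defensive.

(* The vertex set is 'I_n = {0, ..., n-1} instead of {1, ..., n}; only the
   order of the vertices matters for crossings. *)
Record sgraph (n : nat) := SGraph {
  edges : {set {set 'I_n}};
  _ : [forall e in edges, #|e| == 2] }.

HB.instance Definition _ (n : nat) := [isSub for @edges n].
HB.instance Definition _ (n : nat) := [Finite of sgraph n by <:].

Section Graph.
Variable n : nat.
Implicit Types (G : sgraph n) (s : {perm 'I_n}).

Definition adj G (v w : 'I_n) : bool := [set v; w] \in edges G.

Definition num_edges G : nat := #|edges G|.

Definition degree G (v : 'I_n) : nat := #|[set w | adj G v w]|.

Definition max_degree G : nat := \max_(v < n) degree G v.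

(* adj is symmetric, but the condition s a > s c > s b > s d fixes the order in
   which the two edges and their endpoints are listed, so that a pair of
   crossing edges is counted exactly once. *)
Definition crossing G s (q : 'I_n * 'I_n * 'I_n * 'I_n) : bool :=
  let: (a, b, c, d) := q in
  [&& adj G a b, adj G c d, s c < s a, s b < s c & s d < s b].

Definition num_crossings G s : nat := #|[set q | crossing G s q]|.

End Graph.

From mathcomp Require Import all_classical all_reals all_analysis.

Import Order.TTheory GRing.Theory Num.Theory.

Local Open Scope classical_set_scope.
Local Open Scope ring_scope.

Section DiscreteRandomElements.
Context d (T : measurableType d) (R : realType) (P : probability T R).

(* Measurability for the power set sigma-algebra on the codomain. *)
Definition discrete_rv (U : Type) (f : T -> U) : Prop :=
  forall A : set U, measurable (f @^-1` A).

Definition uniform_rv (U : finType) (f : T -> U) : Prop :=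
  forall u : U, P (f @^-1` [set u]) = (#|U|%:R^-1)%:E.

Definition independent_rv (U V : Type) (f : T -> U) (g : T -> V) : Prop :=
  forall (A : set U) (B : set V),
    P (f @^-1` A `&` g @^-1` B) = (P (f @^-1` A) * P (g @^-1` B))%E.

(* f takes the value u i with probability p i. When u is injective this says
   P(f = u i) = p i for all i (and f takes other values with probability 0);
   when values are repeated in the family u, their weights add up. *)
Definition has_mixture_law (U : Type) (I : choiceType) (f : T -> U)
    (u : I -> U) (p : I -> R) : Prop :=
  forall v : U, P (f @^-1` [set v]) = \esum_(i in [set i | u i = v]) (p i)%:E.

(* Elementary conditional expectation and variance given an event A; they are
   meaningful for P A > 0 and X square integrable (0 if P A = 0). *)
Definition cond_expectation (X : T -> R) (A : set T) : R :=
  fine ('E_P[X \* \1_A])%E / fine (P A).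

Definition cond_variance (X : T -> R) (A : set T) : R :=
  cond_expectation (fun w => (X w - cond_expectation X A) ^+ 2) A.

End DiscreteRandomElements.

Section Distributions.
Context (R : realType).

(* normal_prob takes the standard deviation, and has a different convention
   for standard deviation 0. *)
Definition normal_cdf (mu var x : R) : \bar R :=
  if var == 0 then \d_mu `]-oo, x]
  else normal_prob mu (Num.sqrt var) `]-oo, x].

Definition kolmogorov_dist (F H : R -> \bar R) : \bar R :=
  ereal_sup (range (fun x => `|F x - H x|%E)).

End Distributions.

(* Main.v *)
(* Write X for the number of crossings of a fixed graph and h_q for the centered
   indicator that the pair q = (ab, cd) of disjoint oriented edges crosses, so that
   8 (X - E X) is the sum of the h_q. Exactly one of the three pairings ab|cd, ac|bd, ad|bc of
   four points crosses; hence h_q averages to zero over {id, (b c), (b d)}, and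
     8 E [(X - E X) f(X)] = 2/3 sum_q E [h_(ac|bd) (f(X o (b c)) - f(X))],
   a coupling to which Stein's method applies: a transposition changes X by O(m).
   The same averaging shows that Cov(h_q, h_r) = 0 when q and r share at most one
   vertex, while it is 1/45 when they share exactly an edge; the remaining pairs
   are O(m^2) in number, so Var X is of order m^3. Functions of the relative
   orders of disjoint vertex sets are independent, which bounds the variance of
   the drift of the coupling by O(m^5) = O((Var X)^2 / m). Each ingredient of the
   Stein bound is then O(m^(-1/2)); the jump part is controlled by a concentration
   inequality obtained by applying the coupling to a function whose derivative
   varies slowly in relative terms. The mixture is a finite convex combination
   of these estimates, because there are finitely many graphs on n vertices. *)
Require Import Defs.
From HB Require Import structures.
From mathcomp Require Import all_boot all_order all_fingroup all_algebra.
From mathcomp Require Import all_classical all_reals all_analysis.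
From mathcomp Require Import zify ring lra.

Set Implicit Arguments.
Unset Strict Implicit.
Unset Printing Implicit Defensive.

Import Order.TTheory GRing.Theory Num.Theory.
Import numFieldNormedType.Exports.

Local Open Scope classical_set_scope.
Local Open Scope ring_scope.

(** * Stein's equation for the normal distribution *)

Section NormalStein.
Context (R : realType).
Implicit Types (x y z w : R) (f g : R -> R).

Lemma deriv_mul f g x (df dg : R) : is_derive x 1 f df -> is_derive x 1 g dg ->
  is_derive x 1 (fun y => f y * g y) (f x * dg + g x * df).
Proof. by move=> hf hg; apply: is_deriveM. Qed.

Lemma deriv_opp f x (df : R) :
  is_derive x 1 f df -> is_derive x 1 (fun y => - f y) (- df).
Proof. by move=> hf; apply: is_deriveN. Qed.

Lemma deriv_scale c f x (df : R) :
  is_derive x 1 f df -> is_derive x 1 (fun y => c * f y) (c * df).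
Proof. by move=> hf; apply: is_deriveZ. Qed.

Lemma deriv_shift c f x (df : R) :
  is_derive x 1 f df -> is_derive x 1 (fun y => c - f y) (- df).
Proof.
move=> hf; rewrite -[- df]add0r.
by apply: (is_deriveD (f := cst c)); apply: deriv_opp.
Qed.

Lemma deriv_add f g x (df dg : R) : is_derive x 1 f df -> is_derive x 1 g dg ->
  is_derive x 1 (fun y => f y + g y) (df + dg).
Proof. by move=> hf hg; apply: is_deriveD. Qed.

Lemma mean_value f (df : R -> R) x y : x <= y ->
  (forall u, x <= u <= y -> is_derive u 1 f (df u)) ->
  exists2 c, x <= c <= y & f y - f x = df c * (y - x).
Proof.
move=> xy hf; have [] := @MVT_segment R f df x y xy.
- by move=> u; rewrite in_itv/= => /andP[/ltW a /ltW b]; apply: hf; rewrite a.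
- apply: derivable_within_continuous => u; rewrite in_itv/= => /hf.
  by move=> [].
- by move=> c; rewrite in_itv/=; exists c.
Qed.

(** The coefficient [c] is -1 for the Gaussian density and 1 for its reciprocal. *)
Lemma deriv_expR_halfsqr c x :
  is_derive x 1 (fun y => expR (c * y ^+ 2 / 2)) (c * x * expR (c * x ^+ 2 / 2)).
Proof.
have h : is_derive x 1 (fun y => (c / 2) * (y * y)) (c * x).
  have := deriv_scale (c / 2) (deriv_mul (is_derive_id x 1) (is_derive_id x 1)).
  by congr (is_derive _ _ _ _); field.
have -> : (fun y => expR (c * y ^+ 2 / 2)) = expR \o (fun y => (c / 2) * (y * y)).
  by apply/funext => y /=; congr expR; field.
have := is_derive1_comp (is_derive_expR _) h.
by congr (is_derive _ _ _ _); rewrite /= mulrC; congr (_ * expR _); field.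
Qed.

Definition gauss k x := k * expR (- 1 * x ^+ 2 / 2).

Lemma deriv_gauss k x : is_derive x 1 (gauss k) (- x * gauss k x).
Proof.
have := deriv_scale k (deriv_expR_halfsqr (- 1) x).
by congr (is_derive _ _ _ _); rewrite /gauss; ring.
Qed.

Lemma gauss_gt0 k x : 0 < k -> 0 < gauss k x.
Proof. by move=> k0; rewrite mulr_gt0// expR_gt0. Qed.

(* The properties of the standard normal distribution function that Stein's
   method uses; k stands for 1 / sqrt (2 pi), but its value plays no role. *)
Definition normal_like k (Phi : R -> R) :=
  [/\ forall x, is_derive x 1 Phi (gauss k x),
      forall x, 0 <= Phi x <= 1,
      forall e, 0 < e -> exists N, forall y, y <= N -> Phi y <= e &
      forall e, 0 < e -> exists N, forall y, N <= y -> 1 - Phi y <= e].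

Lemma gaussN k x : gauss k (- x) = gauss k x.
Proof. by rewrite /gauss sqrrN. Qed.

(** Reduces the upper tail in [mills_right] to the lower tail in [mills_left]. *)
Lemma normal_like_reflect k Phi :
  normal_like k Phi -> normal_like k (fun x => 1 - Phi (- x)).
Proof.
move=> [d b l r]; split.
- move=> x.
  have := deriv_shift 1 (is_derive1_comp (d (- x)) (is_deriveNid x 1)).
  by congr (is_derive _ _ _ _); rewrite gaussN; ring.
- by move=> x; have /andP[] := b (- x); rewrite subr_ge0 gerBl => -> ->.
- move=> e e0; have [N hN] := r _ e0; exists (- N) => y yN.
  by apply: hN; lra.
- move=> e e0; have [N hN] := l _ e0; exists (- N) => y yN.
  by rewrite subKr; apply: hN; lra.
Qed.

(* For fixed x, the function y |-> gauss y + x * Phi y is nondecreasing on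
   ]-oo, x]; if it were negative at x, Phi would not vanish at -oo. *)
Lemma mills_left k Phi x : 0 < k -> normal_like k Phi ->
  - x * Phi x <= gauss k x.
Proof.
move=> k0 [d b l _].
have [x0|x0] := leP 0 x.
  rewrite (le_trans _ (ltW (gauss_gt0 _ k0)))// mulNr oppr_le0 mulr_ge0//.
  by have /andP[] := b x.
rewrite leNgt; apply/negP => hx.
(* Once [Phi y <= e], the function at [y] is above minus half the defect
   [- (gauss k x + x * Phi x)], whereas monotonicity puts it below minus the whole defect. *)
pose e := - (gauss k x + x * Phi x) / - x / 2.
have e0 : 0 < e by rewrite !divr_gt0//; lra.
have [N hN] := l _ e0.
pose y := Num.min N x.
have yx : y <= x by rewrite ge_min lexx orbT.
have /hN he : y <= N by rewrite ge_min lexx.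
have [c /andP[yc cx]] := @mean_value (fun u => gauss k u + x * Phi u)
  (fun u => - u * gauss k u + x * gauss k u) y x yx
  (fun u _ => deriv_add (deriv_gauss k u) (deriv_scale x (d u))).
have -> : - c * gauss k c + x * gauss k c = (x - c) * gauss k c by ring.
have : 0 <= (x - c) * gauss k c * (x - y).
  by rewrite !mulr_ge0 ?subr_ge0// ltW// gauss_gt0.
have := gauss_gt0 y k0.
move=> g0 h1 h2.
have : - x * e * 2 = - (gauss k x + x * Phi x).
  by rewrite /e; field; lra.
have : - x * Phi y <= - x * e by rewrite ler_wpM2l//; lra.
nra.
Qed.

Lemma mills_right k Phi x : 0 < k -> normal_like k Phi ->
  x * (1 - Phi x) <= gauss k x.
Proof.
move=> k0 h; have := mills_left (- x) k0 (normal_like_reflect h).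
by rewrite gaussN !opprK.
Qed.

End NormalStein.

(** * The bounded solution of Stein's equation for a half-line *)

Section SteinSolution.
Context (R : realType).
Implicit Types (x y z w c : R) (f g : R -> R).

(** On each side of [z] Stein's equation reads f' = x f + a with [a] constant; the bounds are those
    for f and f'. *)
Definition stein_deriv_bounds f (a B x : R) :=
  [/\ is_derive x 1 f (x * f x + a), `|f x| <= B & `|x * f x + a| <= 2].

Lemma mean_value_minmax f (df : R -> R) x y :
  (forall u, Num.min x y <= u <= Num.max x y -> is_derive u 1 f (df u)) ->
  exists2 c, Num.min x y <= c <= Num.max x y & f y - f x = df c * (y - x).
Proof.
have [xy|/ltW yx] := leP x y => h.
  by have [c] := mean_value xy h; exists c.
have [c hc e] := mean_value yx h; exists c => //.
by rewrite -opprB e -mulrN opprB.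
Qed.

Lemma dist_minmax c x y : Num.min x y <= c <= Num.max x y ->
  `|c - x| <= `|y - x|.
Proof.
have [xy|yx] := leP x y => /andP[h1 h2].
  by rewrite !ger0_norm; lra.
by rewrite !ler0_norm; lra.
Qed.

(** The derivative at an intermediate point [c] differs from the one at [w] by (c - w) f c + w (f c
    - f w). The bound [B] controls the first term, the Lipschitz constant 2 the second. *)
Lemma stein_taylor_smooth f a B w w' :
  (forall u, Num.min w w' <= u <= Num.max w w' -> stein_deriv_bounds f a B u) ->
  `|f w' - f w| <= 2 * `|w' - w| /\
  `|f w' - f w - (w' - w) * (w * f w + a)| <=
    `|w' - w| * (`|w' - w| * (B + 2 * `|w|)).
Proof.
move=> h.
have lip u : Num.min w w' <= u <= Num.max w w' -> `|f u - f w| <= 2 * `|u - w|.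
  move=> hu; have hsub v : Num.min w u <= v <= Num.max w u ->
      Num.min w w' <= v <= Num.max w w'.
    move: hu => /andP[hu1 hu2] /andP[hv1 hv2]; apply/andP; split.
      by rewrite (le_trans _ hv1)// le_min ge_min lexx hu1.
    by rewrite (le_trans hv2)// ge_max le_max lexx hu2.
  have [|c hc ->] := @mean_value_minmax f (fun u => u * f u + a) w u.
    by move=> v /hsub/h[].
  by rewrite normrM ler_wpM2r//; have [] := h _ (hsub _ hc).
split.
  by apply: lip; rewrite ge_min le_max !lexx !orbT.
have [|c hc ->] := @mean_value_minmax f (fun u => u * f u + a) w w'.
  by move=> v /h[].
have -> : (c * f c + a) * (w' - w) - (w' - w) * (w * f w + a) =
  (w' - w) * ((c - w) * f c + w * (f c - f w)) by ring.
rewrite normrM ler_wpM2l// (le_trans (ler_normD _ _))// [leRHS]mulrDr.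
have hcw := dist_minmax hc.
apply: lerD; rewrite normrM.
  by apply: ler_pM => //; have [] := h _ hc.
have := lip _ hc; have : 0 <= `|w| by [].
move=> hw hl; rewrite mulrA [X in _ <= X]mulrC ler_wpM2l// (le_trans hl)//.
by rewrite [_ * 2]mulrC ler_pM2l.
Qed.

Context (k : R) (Phi : R -> R).
Hypotheses (k0 : 0 < k) (hPhi : normal_like k Phi).

Let expsqr x : R := expR (1 * x ^+ 2 / 2).

Let gauss_expsqr x : gauss k x * (expsqr x / k) = 1.
Proof.
have e1 : expR (- 1 * x ^+ 2 / 2) * expsqr x = 1.
  by rewrite /expsqr -expRD -[RHS]expR0; congr expR; field.
transitivity (k / k * (expR (- 1 * x ^+ 2 / 2) * expsqr x)).
  by rewrite /gauss; ring.
by rewrite e1 mulr1 divff// gt_eqF.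
Qed.

Let expsqr_ge0 x : 0 <= expsqr x / k.
Proof. by rewrite divr_ge0 ?expR_ge0// ltW. Qed.

Let Phi_ge0 x : 0 <= Phi x. Proof. by case: hPhi => _ /(_ x)/andP[]. Qed.
Let Phi_le1 x : Phi x <= 1. Proof. by case: hPhi => _ /(_ x)/andP[]. Qed.

Let Phi_mono x y : x <= y -> Phi x <= Phi y.
Proof.
move=> xy; have [d _ _ _] := hPhi.
have [c _ e] := mean_value xy (fun u _ => d u).
by rewrite -subr_ge0 e mulr_ge0 ?subr_ge0// ltW// gauss_gt0.
Qed.

Let millsL x : - x * (Phi x * (expsqr x / k)) <= 1.
Proof.
by have := ler_wpM2r (expsqr_ge0 x) (mills_left x k0 hPhi); rewrite gauss_expsqr !mulrA.
Qed.

Let millsR x : x * ((1 - Phi x) * (expsqr x / k)) <= 1.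
Proof.
by have := ler_wpM2r (expsqr_ge0 x) (mills_right x k0 hPhi); rewrite gauss_expsqr !mulrA.
Qed.

(* A majorant of stein_sol z, uniform in z. *)
Let env x := Phi x * (1 - Phi x) * (expsqr x / k).

Let env_ge0 x : 0 <= env x.
Proof. by apply: mulr_ge0 => //; apply: mulr_ge0 => //; rewrite subr_ge0. Qed.

Let norm_mul_env x : `|x| * env x <= 1.
Proof.
have := Phi_ge0 x; have := Phi_le1 x; have := millsL x; have := millsR x.
have := expsqr_ge0 x; rewrite /env.
move: (Phi x) (expsqr x / k) => p e e0 r l p1 p0.
have [x0|/ltW x0] := leP 0 x.
  rewrite ger0_norm// [leLHS](_ : _ = p * (x * ((1 - p) * e))); last by ring.
  by rewrite mulr_ile1// !mulr_ge0// subr_ge0.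
rewrite ler0_norm// [leLHS](_ : _ = (1 - p) * (- x * (p * e))); last by ring.
by rewrite mulr_ile1// ?mulr_ge0//; lra.
Qed.

(** For |x| >= 1, [norm_mul_env] gives [env x <= 1]; for |x| < 1, the exponential in [env x] is at
    most [expR 1]. *)
Definition stein_bound := expR 1 / k + 1.

Let env_le x : env x <= stein_bound.
Proof.
have e1 : 0 <= expR 1 / k by rewrite divr_ge0 ?expR_ge0// ltW.
have [x1|x1] := leP 1 `|x|.
  have := norm_mul_env x; have := env_ge0 x; rewrite /stein_bound; nra.
rewrite /stein_bound (@le_trans _ _ (expR 1 / k))//; last by lra.
have : Phi x * (1 - Phi x) <= 1.
  by have := Phi_ge0 x; have := Phi_le1 x; nra.
move=> h; rewrite (@le_trans _ _ (expsqr x / k))//.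
  by rewrite /env ler_piMl.
rewrite ler_wpM2r ?invr_ge0 ?(ltW k0)// ler_expR.
have : `|x| ^+ 2 <= 1 by rewrite expr_le1// ltW.
by rewrite real_normK ?num_real//; lra.
Qed.

(** The bounded solution of f' w - w f w = 1(w <= z) - Phi z. The two branches are the values of the
    integral of the right-hand side against the density over ]-oo, w], which is then divided by the
    density. *)
Definition stein_sol z w : R :=
  (if w <= z then (1 - Phi z) * Phi w else Phi z * (1 - Phi w)) *
    (expR (1 * w ^+ 2 / 2) / k).

Let solL z w := (1 - Phi z) * Phi w * (expR (1 * w ^+ 2 / 2) / k).
Let solR z w := Phi z * (1 - Phi w) * (expR (1 * w ^+ 2 / 2) / k).

Let d_expsqr x : is_derive x 1 (fun y => expsqr y / k) (x * (expsqr x / k)).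
Proof.
have := deriv_scale k^-1 (deriv_expR_halfsqr 1 x).
have -> : (fun y : R => k^-1 * expR (1 * y ^+ 2 / 2)) = (fun y => expsqr y / k).
  by apply/funext => y; rewrite mulrC.
by congr (is_derive _ _ _ _); rewrite /expsqr; ring.
Qed.

Let d_solL z w : is_derive w 1 (solL z) (w * solL z w + (1 - Phi z)).
Proof.
have [d _ _ _] := hPhi.
have := deriv_mul (deriv_scale (1 - Phi z) (d w)) (d_expsqr w).
congr (is_derive _ _ _ _).
transitivity (w * solL z w + (1 - Phi z) * (gauss k w * (expsqr w / k))).
  by rewrite /solL -/(expsqr w); ring.
by rewrite gauss_expsqr mulr1.
Qed.

Let d_solR z w : is_derive w 1 (solR z) (w * solR z w + - Phi z).
Proof.
have [d _ _ _] := hPhi.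
have := deriv_mul (deriv_scale (Phi z) (deriv_shift 1 (d w))) (d_expsqr w).
congr (is_derive _ _ _ _).
transitivity (w * solR z w + - Phi z * (gauss k w * (expsqr w / k))).
  by rewrite /solR -/(expsqr w); ring.
by rewrite gauss_expsqr mulr1.
Qed.

Let solL_env z w : w <= z -> 0 <= solL z w <= env w.
Proof.
move=> wz; apply/andP; split.
  apply: mulr_ge0; last exact: expsqr_ge0.
  by apply: mulr_ge0 => //; rewrite subr_ge0.
apply: ler_wpM2r; first exact: expsqr_ge0.
by rewrite mulrC ler_wpM2l// lerD2l lerN2 Phi_mono.
Qed.

Let solR_env z w : z <= w -> 0 <= solR z w <= env w.
Proof.
move=> wz; apply/andP; split.
  apply: mulr_ge0; last exact: expsqr_ge0.
  by apply: mulr_ge0 => //; rewrite subr_ge0.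
apply: ler_wpM2r; first exact: expsqr_ge0.
by rewrite ler_wpM2r ?subr_ge0// Phi_mono.
Qed.

Let env_bounds f a w : `|a| <= 1 -> 0 <= f w <= env w ->
  `|f w| <= stein_bound /\ `|w * f w + a| <= 2.
Proof.
move=> a1 /andP[f0 fe]; split.
  by rewrite ger0_norm// (le_trans fe).
rewrite (le_trans (ler_normD _ _))// (_ : 2 = 1 + 1 :> R)// lerD//.
by rewrite normrM (le_trans _ (norm_mul_env w))// ler_wpM2l// ger0_norm.
Qed.

Let solL_bounds z w : w <= z ->
  stein_deriv_bounds (solL z) (1 - Phi z) stein_bound w.
Proof.
move=> wz; have [|h1 h2] := @env_bounds (solL z) (1 - Phi z) w _ (solL_env wz).
  by rewrite ger0_norm ?subr_ge0// gerBl.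
by split.
Qed.

Let solR_bounds z w : z <= w ->
  stein_deriv_bounds (solR z) (- Phi z) stein_bound w.
Proof.
move=> wz; have [|h1 h2] := @env_bounds (solR z) (- Phi z) w _ (solR_env wz).
  by rewrite normrN ger0_norm.
by split.
Qed.

Let stein_solL z w : w <= z -> stein_sol z w = solL z w.
Proof. by rewrite /stein_sol => ->. Qed.

Let stein_solR z w : z <= w -> stein_sol z w = solR z w.
Proof.
rewrite /stein_sol /solR; have [wz zw|//] := leP w z.
have -> : w = z by apply/eqP; rewrite eq_le wz zw.
by rewrite [in LHS]mulrC [in RHS]mulrC; congr (_ * _); ring.
Qed.

(** The derivative of [stein_sol z] away from [z]; at [z] it is the left derivative. *)
Definition stein_rhs z w : R := w * stein_sol z w + ((w <= z)%R%:R - Phi z).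

Lemma stein_sol_bound z w :
  `|stein_sol z w| <= stein_bound /\ `|stein_rhs z w| <= 2.
Proof.
rewrite /stein_rhs; have [wz|/ltW wz] := leP w z.
  by rewrite stein_solL//; have [] := solL_bounds wz.
by rewrite stein_solR// sub0r; have [] := solR_bounds wz.
Qed.

(** If [w] and [w'] lie on the same side of [z], the smooth estimate applies. Otherwise [z] is
    within [|w' - w|] of [w], and the increment (split at [z]) and the linear term are each at most
    [2 * |w' - w|], whence the 4. *)
Lemma stein_sol_taylor z w w' :
  `|stein_sol z w' - stein_sol z w - (w' - w) * stein_rhs z w| <=
  `|w' - w| * (`|w' - w| * (stein_bound + 2 * `|w|) +
               4 * (`|w - z| <= `|w' - w|)%R%:R).
Proof.
have B0 : 0 <= stein_bound + 2 * `|w|.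
  rewrite addr_ge0 ?mulr_ge0//.
  by apply: le_trans (normr_ge0 _) (stein_sol_bound z w).1.
have sideL u v : u <= z -> v <= z ->
    `|stein_sol z v - stein_sol z u| <= 2 * `|v - u| /\
    `|stein_sol z v - stein_sol z u - (v - u) * stein_rhs z u| <=
    `|v - u| * (`|v - u| * (stein_bound + 2 * `|u|)).
  move=> uz vz; rewrite /stein_rhs uz !stein_solL//.
  apply: stein_taylor_smooth => x /andP[_ hx]; apply: solL_bounds.
  by rewrite (le_trans hx)// ge_max uz.
have sideR u v : z <= u -> z <= v ->
    `|stein_sol z v - stein_sol z u| <= 2 * `|v - u| /\
    (z < u ->
    `|stein_sol z v - stein_sol z u - (v - u) * stein_rhs z u| <=
    `|v - u| * (`|v - u| * (stein_bound + 2 * `|u|))).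
  move=> zu zv; rewrite /stein_rhs !stein_solR//.
  have [|h1 h2] := @stein_taylor_smooth (solR z) (- Phi z) stein_bound u v.
    move=> x /andP[hx _]; apply: solR_bounds.
    by rewrite (le_trans _ hx)// le_min zu.
  by split=> // zu'; rewrite (lt_geF zu') sub0r.
have straddle : `|w - z| <= `|w' - w| ->
    `|stein_sol z w' - stein_sol z w| <= 2 * `|w' - w| ->
    `|stein_sol z w' - stein_sol z w - (w' - w) * stein_rhs z w| <=
    `|w' - w| * (`|w' - w| * (stein_bound + 2 * `|w|) +
               4 * (`|w - z| <= `|w' - w|)%R%:R).
  move=> -> /= h; rewrite mulr1 (le_trans (ler_normB _ _))//.
  rewrite [`|_ * stein_rhs _ _|]normrM.
  have [_ h2] := stein_sol_bound z w.
  have : `|w' - w| * `|stein_rhs z w| <= `|w' - w| * 2 by rewrite ler_wpM2l.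
  have : 0 <= `|w' - w| * (`|w' - w| * (stein_bound + 2 * `|w|)).
    by rewrite !mulr_ge0.
  lra.
have same (b : bool) :
    `|stein_sol z w' - stein_sol z w - (w' - w) * stein_rhs z w| <=
    `|w' - w| * (`|w' - w| * (stein_bound + 2 * `|w|)) ->
    `|stein_sol z w' - stein_sol z w - (w' - w) * stein_rhs z w| <=
    `|w' - w| * (`|w' - w| * (stein_bound + 2 * `|w|) + 4 * b%:R).
  move=> /le_trans; apply; rewrite ler_wpM2l// lerDl.
  by rewrite mulr_ge0.
have [wz|zw] := leP w z; have [w'z|zw'] := leP w' z.
- by apply: same; have [] := sideL _ _ wz w'z.
- apply: straddle.
    by rewrite ler0_norm ?ger0_norm; lra.
  have [h1 _] := sideL _ _ wz (lexx z); have [h2 _] := sideR _ _ (lexx z) (ltW zw').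
  rewrite -(subrKA (stein_sol z z)) (le_trans (ler_normD _ _))//.
  rewrite (le_trans (lerD h2 h1))// !ger0_norm; lra.
- apply: straddle.
    by rewrite ger0_norm ?ler0_norm; lra.
  have [h1 _] := sideL _ _ (lexx z) w'z; have [h2 _] := sideR _ _ (ltW zw) (lexx z).
  rewrite -(subrKA (stein_sol z z)) (le_trans (ler_normD _ _))//.
  rewrite (le_trans (lerD h1 h2))// !ler0_norm; lra.
- by apply: same; have [_] := sideR _ _ (ltW zw) (ltW zw'); apply.
Qed.

End SteinSolution.

(** * Stein couplings with bounded jumps *)

Section Average.
Context (R : realType) (U : finType).
Implicit Types (F H : U -> R).

Definition avg F : R := (\sum_(s : U) F s) / #|U|%:R.

Lemma eq_avg F H : F =1 H -> avg F = avg H.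
Proof. by move=> h; rewrite /avg; congr (_ / _); apply: eq_bigr. Qed.

Lemma avgD F H : avg (fun s => F s + H s) = avg F + avg H.
Proof. by rewrite /avg big_split mulrDl. Qed.

Lemma avgN F : avg (fun s => - F s) = - avg F.
Proof. by rewrite /avg sumrN mulNr. Qed.

Lemma avgB F H : avg (fun s => F s - H s) = avg F - avg H.
Proof. by rewrite avgD avgN. Qed.

Lemma avgZ c F : avg (fun s => c * F s) = c * avg F.
Proof. by rewrite /avg -mulr_sumr mulrA. Qed.

Lemma avg_sum (J : Type) (r : seq J) (P : pred J) (F : J -> U -> R) :
  avg (fun s => \sum_(j <- r | P j) F j s) = \sum_(j <- r | P j) avg (F j).
Proof. by rewrite /avg exchange_big mulr_suml. Qed.

Lemma ler_avg F H : (forall s, F s <= H s) -> avg F <= avg H.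
Proof.
by move=> h; rewrite ler_wpM2r ?invr_ge0// ler_sum.
Qed.

Lemma avg_ge0 F : (forall s, 0 <= F s) -> 0 <= avg F.
Proof. by move=> h; rewrite mulr_ge0 ?invr_ge0// sumr_ge0. Qed.

Lemma ler_norm_avg F : `|avg F| <= avg (fun s => `|F s|).
Proof.
rewrite /avg normrM [`|_^-1|]ger0_norm ?invr_ge0//.
by rewrite ler_wpM2r ?invr_ge0// ler_norm_sum.
Qed.

Hypothesis U0 : (0 < #|U|)%N.

Lemma avg_cst c : avg (fun=> c) = c.
Proof.
have h : \sum_(s : U) c = c * #|U|%:R by rewrite sumr_const mulr_natr.
by rewrite /avg h mulfK// pnatr_eq0 -lt0n.
Qed.

(** The pointwise inequality 2 c |F| <= c^2 + F^2 replaces Cauchy-Schwarz. *)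
Lemma avg_norm_le F c : 0 < c -> avg (fun s => F s ^+ 2) <= c ^+ 2 ->
  avg (fun s => `|F s|) <= c.
Proof.
move=> c0 h; have : avg (fun s => 2 * c * `|F s|) <= avg (fun s => c ^+ 2 + F s ^+ 2).
  apply: ler_avg => s; rewrite -[F s ^+ 2]real_normK ?num_real//.
  have := sqr_ge0 (c - `|F s|); nra.
rewrite avgZ avgD avg_cst.
nra.
Qed.

End Average.

(** * Concentration and normal approximation for a Stein coupling *)

Section SteinCoupling.
Context (R : realType).

(** A differentiable truncation to [-l, l] with derivative [dsoft l]. The derivative decays only
    polynomially, so the Taylor remainder over a step of size at most [b] is a small multiple of the
    derivative itself and can be absorbed into it. *)
Let soft (l x : R) := l * x / (l + `|x|).
Let dsoft (l x : R) := (l / (l + `|x|)) ^+ 2.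

Let soft_le l x : 0 < l -> `|soft l x| <= l.
Proof.
move=> l0; have p : 0 < l + `|x| by rewrite ltr_pwDl.
rewrite /soft normrM normfV [`|l + _|]gtr0_norm// ler_pdivrMr//.
by rewrite normrM gtr0_norm// ler_wpM2l ?(ltW l0)// lerDr ltW.
Qed.

Let dsoft_ge0 l x : 0 <= dsoft l x. Proof. exact: sqr_ge0. Qed.

Let dsoft_le1 l x : 0 < l -> dsoft l x <= 1.
Proof.
move=> l0; have p : 0 < l + `|x| by rewrite ltr_pwDl.
rewrite expr_le1// ?divr_ge0 ?(ltW p) ?(ltW l0)//.
by rewrite ler_pdivrMr// mul1r lerDl.
Qed.

Let dsoft_near l b x : 0 < b -> b <= l -> `|x| <= b -> 4^-1 <= dsoft l x.
Proof.
move=> b0 bl xb; have l0 : 0 < l by apply: lt_le_trans bl.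
have p : 0 < l + `|x| by rewrite ltr_pwDl.
have h : 2^-1 <= l / (l + `|x|) by rewrite ler_pdivlMr// mulrC; lra.
rewrite /dsoft expr2; nra.
Qed.

Let soft_taylor l b x y : 0 < b -> b <= l -> `|y - x| <= b ->
  `|soft l y - soft l x - (y - x) * dsoft l x| <=
  `|y - x| * (5 * b / l * dsoft l x).
Proof.
move=> b0 bl yx; have l0 : 0 < l by apply: lt_le_trans bl.
have px : 0 < l + `|x| by rewrite ltr_pwDl.
have py : 0 < l + `|y| by rewrite ltr_pwDl.
have nx : l + `|x| != 0 by rewrite gt_eqF.
have ny : l + `|y| != 0 by rewrite gt_eqF.
have nl : l != 0 by rewrite gt_eqF.
(* The numerator of the remainder after the factor [dsoft l x] is taken out. *)
pose e := (y - x) * l * (`|x| - `|y|) + (y * `|x| - x * `|y|) * (l + `|x|).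
have -> : soft l y - soft l x - (y - x) * dsoft l x =
  (e / (l * (l + `|y|))) * dsoft l x.
  rewrite /soft /dsoft /e.
  by move: nx ny => /[swap]; move: (`|x|) (`|y|) => p q ny nx; field; rewrite nx ny.
rewrite normrM [`|dsoft _ _|]ger0_norm// [leRHS]mulrA ler_wpM2r//.
rewrite normrM normfV [`|l * _|]gtr0_norm ?mulr_gt0//.
rewrite ler_pdivrMr ?mulr_gt0//.
rewrite (_ : `|y - x| * (5 * b / l) * (l * (l + `|y|)) =
  `|y - x| * b * l + `|y - x| * b * (4 * l + 5 * `|y|)); last by field.
rewrite (le_trans (ler_normD _ _))// lerD// ?normrM.
  rewrite -mulrA [`|l|]gtr0_norm// -mulrA ler_wpM2l// mulrC ler_wpM2r// ?(ltW l0)//.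
  by rewrite (le_trans _ yx)// -[leRHS]normrN opprB (ler_dist_dist x y).
have xy : `|x| <= `|y| + b.
  by rewrite -lerBlDl (le_trans _ yx)// (le_trans (lerB_dist x y))// distrC.
have y0 := normr_ge0 y; have x0 := normr_ge0 x.
(* Zero when [x] and [y] have the same sign; otherwise it is 2 |x| |y|, and both |x| and |y| are at
   most |y - x| <= b. *)
have : `|y * `|x| - x * `|y| | <= `|y - x| * (2 * b).
  move: yx; have [x0'|/ltW x0'] := leP 0 x; have [y0'|/ltW y0'] := leP 0 y.
  - by rewrite (ger0_norm x0') (ger0_norm y0') mulrC subrr normr0 mulr_ge0//; lra.
  - rewrite (ger0_norm x0') (ler0_norm y0') => hyx.
    rewrite (ler0_norm (x := y - x)) in hyx *; last by lra.
    have h1 : 0 <= x * - y by rewrite mulr_ge0// oppr_ge0.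
    have h2 : x * - y <= x * b by rewrite ler_wpM2l//; lra.
    have h3 : 0 <= - y * b by rewrite mulr_ge0 ?oppr_ge0// ltW.
    by rewrite (_ : y * x - x * - y = - (2 * (x * - y))); [rewrite normrN ger0_norm|]; lra.
  - rewrite (ler0_norm x0') (ger0_norm y0') => hyx.
    rewrite (ger0_norm (x := y - x)) in hyx *; last by lra.
    have h1 : 0 <= - x * y by rewrite mulr_ge0// oppr_ge0.
    have h2 : - x * y <= - x * b by rewrite ler_wpM2l ?oppr_ge0//; lra.
    have h3 : 0 <= y * b by rewrite mulr_ge0// ltW.
    by rewrite (_ : y * - x - x * y = 2 * (- x * y)); [rewrite ger0_norm|]; lra.
  - rewrite (ler0_norm x0') (ler0_norm y0').
    by rewrite (_ : y * - x - x * - y = 0) ?normr0 ?mulr_ge0//; [lra|ring].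
move=> h; rewrite [`|l + _|]gtr0_norm//.
apply: le_trans (ler_wpM2r (ltW px) h) _.
rewrite -mulrA -mulrA ler_wpM2l// -!mulrA mulrCA ler_wpM2l ?(ltW b0)//; lra.
Qed.

Context (U J : finType) (W : U -> R) (W' : J -> U -> R) (g : J -> U -> R).
Context (a b psi : R).
Hypotheses (U0 : (0 < #|U|)%N) (a0 : 0 < a) (b0 : 0 < b) (psi0 : 0 < psi).
Hypothesis coupling : forall f : R -> R, avg (fun s => W s * f (W s)) =
  avg (fun s => \sum_j g j s * (f (W' j s) - f (W s))).
Hypothesis jump : forall j s, `|W' j s - W s| <= b.
Hypothesis weight : forall s, \sum_j `|g j s| <= a.
Hypothesis variance : avg (fun s => W s ^+ 2) = 1.
Hypothesis drift :
  avg (fun s => (\sum_j g j s * (W' j s - W s) - 1) ^+ 2) <= psi ^+ 2.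

Let T s := \sum_j g j s * (W' j s - W s).

Let avg_normW : avg (fun s => `|W s|) <= 1.
Proof. by apply: avg_norm_le => //; rewrite variance expr1n. Qed.

Let avg_drift : avg (fun s => `|T s - 1|) <= psi.
Proof. exact: avg_norm_le. Qed.

(** The coupling turns W f(W) into [T] times df(W) plus Taylor remainders. Replacing [T] by 1 costs
    [c * psi]; the remainders carry total weight at most [a]. *)
Let linearize (f df err : R -> R) (c : R) :
  (forall w, `|df w| <= c) -> (forall w, 0 <= err w) ->
  (forall j s, `|f (W' j s) - f (W s) - (W' j s - W s) * df (W s)| <=
     err (W s)) ->
  `|avg (fun s => W s * f (W s)) - avg (fun s => df (W s))| <=
    c * psi + a * avg (fun s => err (W s)).
Proof.
move=> hc err0 herr; rewrite coupling -avgB.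
have -> : avg (fun s => \sum_j g j s * (f (W' j s) - f (W s)) - df (W s)) =
  avg (fun s => (T s - 1) * df (W s) +
    \sum_j g j s * (f (W' j s) - f (W s) - (W' j s - W s) * df (W s))).
  apply: eq_avg => s; rewrite /T mulrBl mul1r mulr_suml addrAC -big_split/=.
  by congr (_ - _); apply: eq_bigr => j _; ring.
rewrite avgD (le_trans (ler_normD _ _))// lerD//.
  rewrite (le_trans (ler_norm_avg _))//.
  have c0 : 0 <= c by rewrite (le_trans _ (hc 0)).
  rewrite (le_trans _ (ler_wpM2l c0 avg_drift))// -avgZ.
  by apply: ler_avg => s; rewrite normrM mulrC ler_wpM2r.
rewrite (le_trans (ler_norm_avg _))// -avgZ; apply: ler_avg => s.
rewrite (le_trans (ler_norm_sum _ _ _))//.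
rewrite (le_trans _ (ler_wpM2r (err0 (W s)) (weight s)))// mulr_suml ler_sum// => i _.
by rewrite normrM ler_wpM2l.
Qed.

(** Take [f := soft l] shifted by [z]. The left side of [linearize] involves at most l E|W| <= l,
    and the remainder is at most half the average D of the derivative, so D <= 2 (l + psi). On the
    window the derivative is at least 1/4, which gives the factor 8. *)
Lemma stein_concentration z :
  avg (fun s => (`|W s - z| <= b)%R%:R) <= 8 * (b * (10 * (a * b) + 1) + psi).
Proof.
(* Chosen so that [b <= l] and the remainder coefficient [a * b * (5 * b / l)] is at most 1/2. *)
set l := b * (10 * (a * b) + 1).
have ab0 : 0 < a * b by rewrite mulr_gt0.
have bl : b <= l by rewrite ler_pMr//; lra.
have l0 : 0 < l by apply: lt_le_trans bl.
have H : avg (fun s => (`|W s - z| <= b)%R%:R) <=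
    4 * avg (fun s => dsoft l (W s - z)).
  rewrite -avgZ; apply: ler_avg => s; case: (leP _ b) => /=.
    by move=> /(dsoft_near b0 bl); lra.
  by rewrite mulr_ge0.
have dsoft1 w : `|dsoft l (w - z)| <= 1 by rewrite ger0_norm// dsoft_le1.
have k0 : 0 <= 5 * b / l by rewrite divr_ge0 ?(ltW l0)// mulr_ge0// ltW.
have err0 w : 0 <= b * (5 * b / l * dsoft l (w - z)).
  by rewrite mulr_ge0 ?(ltW b0)// mulr_ge0.
have herr j s : `|soft l (W' j s - z) - soft l (W s - z) -
    (W' j s - W s) * dsoft l (W s - z)| <= b * (5 * b / l * dsoft l (W s - z)).
  have -> : W' j s - W s = (W' j s - z) - (W s - z) by ring.
  have hj : `|(W' j s - z) - (W s - z)| <= b.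
    by rewrite (_ : _ - _ = W' j s - W s) ?jump//; ring.
  by rewrite (le_trans (soft_taylor b0 bl hj))// ler_wpM2r// mulr_ge0.
have := linearize (f := fun w => soft l (w - z)) dsoft1 err0 herr.
rewrite mul1r avgZ avgZ.
set D := avg (fun s => dsoft l (W s - z)) in H *.
have -> : a * (b * (5 * b / l * D)) = a * b * (5 * b / l) * D by ring.
have Wf : `|avg (fun s => W s * soft l (W s - z))| <= l.
  apply: le_trans (ler_norm_avg _) _.
  apply: (@le_trans _ _ (l * avg (fun s => `|W s|))).
    by rewrite -avgZ; apply: ler_avg => s; rewrite normrM mulrC ler_wpM2r// soft_le.
  by rewrite -[leRHS]mulr1 ler_wpM2l// ltW.
have D0 : 0 <= D by apply: avg_ge0.
have c2 : a * b * (5 * b / l) <= 2^-1.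
  rewrite (_ : _ * _ = 5 * (a * b) * b / l); last by ring.
  rewrite ler_pdivrMr// /l [leRHS]mulrCA [leLHS]mulrC ler_wpM2l ?(ltW b0)//; lra.
have := ler_wpM2r D0 c2.
move: Wf; rewrite !ler_norml => /andP[_ Wf] ? /andP[? _].
by lra.
Qed.

(** The 32 is the 4 of [stein_sol_taylor] times the 8 of [stein_concentration]; the [+ 2] comes from
    2 E|W| <= 2. *)
Definition stein_const (k : R) :=
  2 * psi + a * b * (b * (stein_bound k + 2) +
    32 * (b * (10 * (a * b) + 1) + psi)).

(** By Stein's equation, the average of df(W) - W f(W) is exactly the error to be bounded. Jumps
    across [z], where the derivative is discontinuous, are charged to [stein_concentration]. *)
Lemma stein_coupling k Phi z : 0 < k -> normal_like k Phi ->
  `|avg (fun s => (W s <= z)%R%:R) - Phi z| <= stein_const k.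
Proof.
move=> k0 hPhi; pose f := stein_sol k Phi z; pose df := stein_rhs k Phi z.
have B0 : 0 <= stein_bound k.
  by rewrite (le_trans _ (stein_sol_bound k0 hPhi z 0).1).
pose err w := b * (b * (stein_bound k + 2 * `|w|) + 4 * (`|w - z| <= b)%R%:R).
have sB0 w : 0 <= stein_bound k + 2 * `|w| by rewrite addr_ge0// mulr_ge0.
have err0 w : 0 <= err w.
  apply: mulr_ge0; first exact: ltW.
  by apply: addr_ge0; [apply: mulr_ge0 => //; exact: ltW|rewrite mulr_ge0].
have hdf w : `|df w| <= 2 by have [] := stein_sol_bound k0 hPhi z w.
have herr j s : `|f (W' j s) - f (W s) - (W' j s - W s) * df (W s)| <= err (W s).
  rewrite (le_trans (stein_sol_taylor k0 hPhi _ _ _))//.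
  have hj := jump j s.
  apply: ler_pM => //; first by apply: addr_ge0; apply: mulr_ge0.
  apply: lerD; first by rewrite ler_wpM2r.
  rewrite ler_wpM2l// ler_nat.
  by case: (leP _ `|W' j s - W s|) => // /le_trans/(_ hj) ->.
have := linearize hdf err0 herr.
have -> : avg (fun s => df (W s)) = avg (fun s => W s * f (W s)) +
    (avg (fun s => (W s <= z)%R%:R) - Phi z).
  by rewrite -[X in _ - X](avg_cst U0) -avgB -avgD.
rewrite opprD addrA subrr sub0r normrN => /le_trans; apply.
rewrite /stein_const lerD//.
rewrite /err avgZ avgD !avgZ -mulrA ler_wpM2l ?(ltW a0)// ler_wpM2l ?(ltW b0)//.
rewrite lerD//.
  rewrite ler_wpM2l ?(ltW b0)// avgD avgZ avg_cst// lerD2l.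
  have := avg_normW; lra.
have := stein_concentration z; lra.
Qed.

End SteinCoupling.

(** * Crossing chords *)

Section ChordPatterns.
Local Open Scope nat_scope.

(* The cyclic orientation of (a, b, c); for fixed a it is a strict total order
   on the other points. *)
Definition orient (a b c : nat) : bool := (a < b) (+) (b < c) (+) (a < c).

(** For distinct points, [(a < c) (+) (b < c)] says that c lies between a and b; the chords ab and
    cd cross when this holds for exactly one of c and d. *)
Definition cross (a b c d : nat) : bool :=
  (a < c) (+) (b < c) (+) ((a < d) (+) (b < d)).

(** Rules out the two sign patterns that break transitivity, where x, y, z compare the first point
    with the second, the second with the third, and the first with the third. *)
Definition acyclic (x y z : bool) : bool :=
  ~~ (x && y && ~~ z) && ~~ (~~ x && ~~ y && z).

Lemma orientN a b c : b != c -> orient a c b = ~~ orient a b c.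
Proof. by rewrite /orient; case: (ltngtP b c); case: (a < b); case: (a < c). Qed.

Lemma orient_acyclic a b c d : uniq [:: a; b; c; d] ->
  acyclic (orient a b c) (orient a c d) (orient a b d).
Proof.
rewrite /= !inE !negb_or -!andbA => /and5P[+ + + + /and3P[+ + _]].
rewrite /acyclic /orient.
case: (ltngtP a b) => // ab; case: (ltngtP a c) => // ac;
case: (ltngtP a d) => // ad; case: (ltngtP b c) => // bc;
case: (ltngtP b d) => // bd; case: (ltngtP c d) => // cd; move=> *; exfalso; lia.
Qed.

Lemma cross_orient a b c d : cross a b c d = orient a b c (+) orient a b d.
Proof.
rewrite /cross /orient.
by case: (a < b); case: (b < c); case: (a < c); case: (b < d); case: (a < d).
Qed.

Lemma crossC a b c d : uniq [:: a; b; c; d] -> cross c d a b = cross a b c d.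
Proof.
rewrite /= !inE !negb_or -!andbA => /and5P[_ + + + /and3P[+ _ _]].
rewrite /cross.
by case: (ltngtP a c); case: (ltngtP a d); case: (ltngtP b c); case: (ltngtP b d).
Qed.

Lemma cross_pairings a b c d : uniq [:: a; b; c; d] ->
  cross a b c d + cross a c b d + cross a d b c = 1.
Proof.
move=> u; have := orient_acyclic u; move: u.
rewrite /= !inE !negb_or -!andbA => /and5P[_ _ _ bc /and3P[bd cd _]].
rewrite !cross_orient (orientN a bc) (orientN a bd) (orientN a cd).
by case: (orient a b c); case: (orient a c d); case: (orient a b d).
Qed.

Definition cross2 a b c d c' d' : nat := cross a b c d && cross a b c' d'.

Definition cross2_pairings a b c d c' d' : nat :=
  cross2 a b c d c' d' + cross2 a b c c' d d' + cross2 a b c d' c' d.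

(* Only the third of the five points following a cyclically contributes, with
   two of the three pairings of the remaining points. *)
Lemma cross2_sum a b c d c' d' : uniq [:: a; b; c; d; c'; d'] ->
  cross2_pairings a b c d c' d' + cross2_pairings a c b d c' d' +
  cross2_pairings a d c b c' d' + cross2_pairings a c' c d b d' +
  cross2_pairings a d' c d c' b = 2.
Proof.
move=> u.
(* The order around [a] of five points is encoded by ten Booleans. Transitivity on the ten triples
   and antisymmetry on the ten pairs reduce the identity to a truth table. *)
have acy x y z : uniq [:: a; x; y; z] -> acyclic (orient a x y) (orient a y z) (orient a x z).
  exact: orient_acyclic.
have sub m : uniq (mask m [:: a; b; c; d; c'; d']) by apply: mask_uniq.
have h1 := acy _ _ _ (sub [:: true; true; true; true]).
have h2 := acy _ _ _ (sub [:: true; true; true; false; true]).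
have h3 := acy _ _ _ (sub [:: true; true; true; false; false; true]).
have h4 := acy _ _ _ (sub [:: true; true; false; true; true]).
have h5 := acy _ _ _ (sub [:: true; true; false; true; false; true]).
have h6 := acy _ _ _ (sub [:: true; true; false; false; true; true]).
have h7 := acy _ _ _ (sub [:: true; false; true; true; true]).
have h8 := acy _ _ _ (sub [:: true; false; true; true; false; true]).
have h9 := acy _ _ _ (sub [:: true; false; true; false; true; true]).
have h0 := acy _ _ _ (sub [:: true; false; false; true; true; true]).
have neq (x y : nat) : uniq [:: x; y] -> x != y by rewrite /= inE andbT.
have n1 := orientN a (neq _ _ (sub [:: false; true; true])).
have n2 := orientN a (neq _ _ (sub [:: false; true; false; true])).
have n3 := orientN a (neq _ _ (sub [:: false; true; false; false; true])).
have n4 := orientN a (neq _ _ (sub [:: false; true; false; false; false; true])).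
have n5 := orientN a (neq _ _ (sub [:: false; false; true; true])).
have n6 := orientN a (neq _ _ (sub [:: false; false; true; false; true])).
have n7 := orientN a (neq _ _ (sub [:: false; false; true; false; false; true])).
have n8 := orientN a (neq _ _ (sub [:: false; false; false; true; true])).
have n9 := orientN a (neq _ _ (sub [:: false; false; false; true; false; true])).
have n0 := orientN a (neq _ _ (sub [:: false; false; false; false; true; true])).
rewrite /cross2_pairings /cross2 !cross_orient n1 n2 n3 n4 n5 n6 n7 n8 n9 n0.
move: h1 h2 h3 h4 h5 h6 h7 h8 h9 h0; clear.
move: (orient a b c) (orient a b d) (orient a b c') (orient a b d').
move: (orient a c d) (orient a c c') (orient a c d').
move: (orient a d c') (orient a d d') (orient a c' d').
by do 10!case.
Qed.

End ChordPatterns.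

(** * Centered crossing indicators under a random permutation *)

Section Permutations.
Context (R : realType) (n : nat).
Local Notation V := 'I_n.
Implicit Types (s t : {perm V}) (a b c d : V) (F H : {perm V} -> R).

Lemma card_perm_gt0 : (0 < #|{perm V}|)%N.
Proof. by apply/card_gt0P; exists 1%g. Qed.

Lemma avg_mulg t F : avg (fun s => F (t * s)%g) = avg F.
Proof. by rewrite /avg [in RHS](reindex_inj (mulgI t)). Qed.

(** Each pairing of four points has crossing probability 1/3. The value 0 on degenerate quadruples
    lets sums range over all pairs of oriented edges and keeps the symmetries unconditional. *)
Definition chord s a b c d : R :=
  if uniq [:: a; b; c; d] then (cross (s a) (s b) (s c) (s d))%:R - 3^-1 else 0.

Lemma uniq_perm_val s (r : seq V) :
  uniq [seq val (s x) | x <- r] = uniq r.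
Proof.
rewrite map_inj_uniq// => x y /val_inj; exact: perm_inj.
Qed.

Lemma chord_norm_le s a b c d : `|chord s a b c d| <= 2 / 3.
Proof.
rewrite /chord; case: ifP => _; last by rewrite normr0; lra.
case: (cross _ _ _ _); rewrite ler_norml /=; apply/andP; split; lra.
Qed.

Lemma chordC s a b c d : chord s c d a b = chord s a b c d.
Proof.
rewrite /chord.
have -> : uniq [:: c; d; a; b] = uniq [:: a; b; c; d].
  by apply: perm_uniq; rewrite (perm_catC [:: c; d] [:: a; b]).
case: ifP => // u; rewrite crossC//.
by rewrite (uniq_perm_val s [:: a; b; c; d]).
Qed.

Lemma chordCl s a b c d : chord s b a c d = chord s a b c d.
Proof.
rewrite /chord.
have -> : uniq [:: b; a; c; d] = uniq [:: a; b; c; d].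
  by apply: perm_uniq; rewrite (perm_catCA [:: b] [:: a] [:: c; d]).
by rewrite /cross (addbC (s b < s c)%N) (addbC (s b < s d)%N).
Qed.

Lemma chordCr s a b c d : chord s a b d c = chord s a b c d.
Proof. by rewrite -chordC chordCl chordC. Qed.

Lemma chord_mulg t s a b c d :
  chord (t * s)%g a b c d = chord s (t a) (t b) (t c) (t d).
Proof.
rewrite /chord !permM.
have -> // : uniq [:: t a; t b; t c; t d] = uniq [:: a; b; c; d].
exact: (map_inj_uniq (@perm_inj _ t) [:: a; b; c; d]).
Qed.

Lemma chord_pairings s a b c d :
  chord s a b c d + chord s a c b d + chord s a d b c = 0.
Proof.
rewrite /chord.
have -> : uniq [:: a; c; b; d] = uniq [:: a; b; c; d].
  by apply: perm_uniq; rewrite perm_cons (perm_catCA [:: c] [:: b] [:: d]).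
have -> : uniq [:: a; d; b; c] = uniq [:: a; b; c; d].
  by apply: perm_uniq; rewrite perm_cons (perm_catC [:: d] [:: b; c]).
case: ifP => u; last by rewrite !addr0.
have : uniq [:: val (s a); val (s b); val (s c); val (s d)].
  by rewrite (uniq_perm_val s [:: a; b; c; d]).
move/cross_pairings => /(congr1 (fun k => k%:R : R)); rewrite !natrD => h.
lra.
Qed.

Lemma chord_tperm2 s a b c d : uniq [:: a; b; c; d] ->
  chord (tperm b c * s)%g a b c d = chord s a c b d.
Proof.
rewrite /= !inE !negb_or -!andbA => /and5P[ab ac ad bc /and3P[bd cd _]].
by rewrite chord_mulg tpermL tpermR !tpermD// eq_sym.
Qed.

(* Averaging over the three pairings of {a, b, c, d}, which are permuted by
   swapping b with c or with d. *)
Lemma chord_ibp a b c d F :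
  avg (fun s => chord s a b c d * F s) =
  3^-1 * avg (fun s => chord s a c b d * (F (tperm b c * s)%g - F s)) +
  3^-1 * avg (fun s => chord s a d c b * (F (tperm b d * s)%g - F s)).
Proof.
have [u|nu] := boolP (uniq [:: a; b; c; d]); last first.
  have z x y z : uniq [:: a; x; y; z] = uniq [:: a; b; c; d] ->
      forall s, chord s a x y z = 0.
    by move=> e s; rewrite /chord e (negbTE nu).
  rewrite /avg !big1 ?mul0r ?mulr0 ?addr0// => s _; rewrite z ?mul0r//.
    apply: perm_uniq; rewrite perm_cons (perm_catC [:: d] [:: c; b]).
    by rewrite (perm_catCA [:: c] [:: b] [:: d]).
  by apply: perm_uniq; rewrite perm_cons (perm_catCA [:: c] [:: b] [:: d]).
have u' : uniq [:: a; b; d; c].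
  by rewrite -(perm_uniq (s1 := [:: a; b; c; d]))// !perm_cons (perm_catC [:: c] [:: d]).
(* With A the left-hand side, [e1] and [e2] make the two increment terms add up to 2 A minus the
   averages over the other pairings, and by [e3] those averages sum to - A. The total is 3 A. *)
have e1 : avg (fun s => chord s a b c d * F s) =
    avg (fun s => chord s a c b d * F (tperm b c * s)%g).
  by rewrite -(avg_mulg (tperm b c)); apply: eq_avg => s; rewrite chord_tperm2.
have e2 : avg (fun s => chord s a b c d * F s) =
    avg (fun s => chord s a d c b * F (tperm b d * s)%g).
  rewrite -(avg_mulg (tperm b d)); apply: eq_avg => s.
  by rewrite -chordCr chord_tperm2// chordCr.
have e3 : avg (fun s => chord s a b c d * F s) = - avg (fun s => chord s a c b d * F s)
    - avg (fun s => chord s a d c b * F s).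
  rewrite -!avgN -avgD; apply: eq_avg => s.
  have := chord_pairings s a b c d; rewrite [chord s a d c b]chordCr => h.
  rewrite (_ : chord s a b c d = - chord s a c b d - chord s a d b c); last by lra.
  ring.
have dist x y z (t : {perm V}) :
    avg (fun s => chord s a x y z * (F (t * s)%g - F s)) =
    avg (fun s => chord s a x y z * F (t * s)%g) - avg (fun s => chord s a x y z * F s).
  by rewrite -avgB; apply: eq_avg => s; rewrite mulrBr.
rewrite !dist -e1 -e2; lra.
Qed.

Lemma avg_chord_mul0 a b c d F :
  (forall s, F (tperm b c * s)%g = F s) -> (forall s, F (tperm b d * s)%g = F s) ->
  avg (fun s => chord s a b c d * F s) = 0.
Proof.
move=> h1 h2; rewrite chord_ibp.
by rewrite /avg !big1 ?mul0r ?mulr0 ?addr0// => s _; rewrite ?h1 ?h2 subrr mulr0.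
Qed.

Lemma avg_chord a b c d : avg (fun s => chord s a b c d) = 0.
Proof.
rewrite -(@avg_chord_mul0 a b c d (fun=> 1))//.
by apply: eq_avg => s; rewrite mulr1.
Qed.

(** Five partners for [a] and three pairings of the other four points give fifteen averages that are
    equal by symmetry and sum to 2 by [cross2_sum]. Hence both crossings occur with probability
    2/15, and 2/15 - 1/9 = 1/45. *)
Lemma avg_chord_common_edge a b c d c' d' : uniq [:: a; b; c; d; c'; d'] ->
  avg (fun s => chord s a b c d * chord s a b c' d') = 45^-1.
Proof.
move=> u.
pose X s x y z w : R := (cross (s x) (s y) (s z) (s w))%:R.
pose P s b c d c' d' : R := (cross2 (s a) (s b) (s c) (s d) (s c') (s d'))%:R.
have sub m : uniq (mask m [:: a; b; c; d; c'; d']) by apply: mask_uniq.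
have uq : uniq [:: a; b; c; d] by apply: (sub [:: true; true; true; true]).
have uq' : uniq [:: a; b; c'; d'] by apply: (sub [:: true; true; false; false; true; true]).
have EX x y z w : uniq [:: x; y; z; w] -> avg (fun s => X s x y z w) = 3^-1.
  move=> v; have := avg_chord x y z w.
  rewrite (eq_avg (H := fun s => X s x y z w - 3^-1)); last by move=> s; rewrite /chord v.
  by rewrite avgB avg_cst ?card_perm_gt0//; lra.
suff EP : avg (fun s => P s b c d c' d') = 2 / 15.
  rewrite (eq_avg (H := fun s => P s b c d c' d' - 3^-1 * X s a b c d -
      3^-1 * X s a b c' d' + 9^-1)).
    rewrite avgD !avgB !avgZ avg_cst ?card_perm_gt0// EP !EX//.
    lra.
  move=> s; rewrite /chord uq uq' /P /X /cross2.
  by case: (cross _ _ _ _); case: (cross _ _ _ _) => /=; lra.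
have pairs x y z w v : uniq [:: a; x; y; z; w; v] ->
    avg (fun s => (cross2_pairings (s a) (s x) (s y) (s z) (s w) (s v))%:R : R) =
    3 * avg (fun s => P s x y z w v).
  rewrite /= !inE !negb_or -!andbA => /and5P[? ? ? ? /and5P[? ? ? ? /and5P[? ? ? ? /and4P[? ? ? _]]]].
  rewrite (eq_avg (H := fun s => P s x y z w v + P (tperm z w * s)%g x y z w v +
     P (tperm z v * s)%g x y z w v)).
    rewrite !avgD (avg_mulg (tperm z w) (fun s => P s x y z w v)).
    by rewrite (avg_mulg (tperm z v) (fun s => P s x y z w v)); lra.
  move=> s; rewrite /P /cross2_pairings !natrD !permM !tpermL !tpermR.
  by rewrite !tpermD//; rewrite eq_sym.
have := u; rewrite /= !inE !negb_or -!andbA.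
move=> /and5P[? ? ? ? /and5P[? ? ? ? /and5P[? ? ? ? /and4P[? ? ? _]]]].
have Pt x : avg (fun s => P (tperm b x * s)%g b c d c' d') = avg (fun s => P s b c d c' d').
  exact: avg_mulg.
have := Pt c; have := Pt d; have := Pt c'; have := Pt d'.
rewrite {1 3 5 7}/P.
rewrite (eq_avg (H := fun s => P s d' c d c' b)); last first.
  by move=> s; rewrite !permM tpermL tpermR !tpermD// eq_sym.
move=> h1.
rewrite (eq_avg (H := fun s => P s c' c d b d')); last first.
  by move=> s; rewrite !permM tpermL tpermR !tpermD// eq_sym.
move=> h2.
rewrite (eq_avg (H := fun s => P s d c b c' d')); last first.
  by move=> s; rewrite !permM tpermL tpermR !tpermD// eq_sym.
move=> h3.
rewrite (eq_avg (H := fun s => P s c b d c' d')); last first.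
  by move=> s; rewrite !permM tpermL tpermR !tpermD// eq_sym.
move=> h4.
pose Q s x y z w v : R :=
  (cross2_pairings (s a) (s x) (s y) (s z) (s w) (s v))%:R.
have : avg (fun s => Q s b c d c' d' + Q s c b d c' d' + Q s d c b c' d' +
    Q s c' c d b d' + Q s d' c d c' b) = 2.
  rewrite -[RHS](avg_cst card_perm_gt0); apply: eq_avg => s.
  rewrite -!natrD cross2_sum// (uniq_perm_val s [:: a; b; c; d; c'; d'])//.
have pu r : perm_eq r [:: b; c; d; c'; d'] -> uniq (a :: r).
  by move=> pr; rewrite (perm_uniq (s2 := [:: a; b; c; d; c'; d']))// perm_cons.
rewrite !avgD /Q !pairs; first by lra.
all: apply: pu; apply/seq.permP => p /=.
all: by case: (p b); case: (p c); case: (p d); case: (p c'); case: (p d').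
Qed.

End Permutations.

(** * Independence of relative orders *)

Section OrderDetermined.
Context (R : realType) (n : nat).
Local Notation V := 'I_n.
Implicit Types (s t : {perm V}) (A B : {set V}) (F G : {perm V} -> R).

Definition same_order A s t : Prop :=
  forall x y, x \in A -> y \in A -> (s x < s y)%N = (t x < t y)%N.

Definition order_determined A F : Prop :=
  forall s t, same_order A s t -> F s = F t.

(* Rearrangement inequality: the concordant arrangement of the values of s on A
   is the one maximizing the correlation with t. *)
Lemma exists_same_order A s t :
  exists2 u : {perm V}, perm_on A u & same_order A (u * s)%g t.
Proof.
pose corr (u : {perm V}) := (\sum_(x : V) t x * s (u x))%N.
have on1 : perm_on A (1 : {perm V})%g by apply: perm_on1.
case: (@arg_maxnP _ 1%g (fun u : {perm V} => perm_on A u) corr on1) => u uA umax.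
have lt_lt x y : x \in A -> y \in A -> (t x < t y)%N -> (s (u x) < s (u y))%N.
  move=> xA yA txy; rewrite ltnNge; apply/negP => syx.
  have xy : x != y by apply: contraTneq txy => ->; rewrite ltnn.
  have {}syx : (s (u y) < s (u x))%N.
    rewrite ltn_neqAle syx andbT; apply: contra_neq xy => /val_inj.
    by move/perm_inj/perm_inj.
  (* Exchanging the values of a discordant pair would strictly increase [corr]. *)
  have /umax : perm_on A (tperm x y * u)%g.
    by apply: perm_onM => //; apply/fintype.subsetP => z; rewrite inE;
      case: tpermP => [->|->|]; rewrite ?eqxx.
  apply/negP; rewrite -ltnNge /corr.
  rewrite (bigD1 x)// (bigD1 y) 1?eq_sym//=.
  rewrite [ltnRHS](bigD1 x)// (bigD1 y (P := fun i => i != x)) 1?eq_sym//=.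
  rewrite !permM tpermL tpermR.
  rewrite [X in (_ < _ + (_ + X))%N](eq_bigr (fun i => t i * s (u i))%N); last first.
    by move=> z /andP[zx zy]; rewrite permM tpermD// eq_sym.
  have swap_lt (p q i j k : nat) : (p < q -> j < i ->
      p * i + (q * j + k) < p * j + (q * i + k))%N by nia.
  exact: swap_lt.
exists u => // x y xA yA; rewrite !permM.
case: (ltngtP (t x) (t y)) => [/(lt_lt _ _ xA yA)//|/(lt_lt _ _ yA xA)|/val_inj/perm_inj->].
  by move=> /ltnW; rewrite leqNgt => /negbTE.
by rewrite ltnn.
Qed.

Let sumA A F s := \sum_(u : {perm V} | perm_on A u) F (u * s)%g.

(** Some [u] supported on [A] makes [u * s] ordered like [t] on [A], and translation by [u] permutes
    the summation range. *)
Let sumA_const A F s t : order_determined A F -> sumA A F s = sumA A F t.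
Proof.
move=> hF; have [u uA hu] := exists_same_order A s t.
rewrite /sumA (reindex_inj (mulIg u)) /=.
apply: eq_big => [v|v vA].
  apply/idP/idP => h; last exact: perm_onM.
  by rewrite -[v](mulgK u); apply: perm_onM => //; apply: perm_onV.
rewrite -mulgA; apply: hF => x y xA yA.
have vA' : perm_on A v.
  by rewrite -[v](mulgK u); apply: perm_onM => //; apply: perm_onV.
by rewrite !(permM v) hu ?perm_closed.
Qed.

(** Composing with permutations supported on [A] leaves [G] unchanged and preserves averages, while
    summing [F] over them gives a constant. *)
Lemma avg_mul_disjoint A B F G : {in A, forall x, x \notin B} ->
  order_determined A F -> order_determined B G ->
  avg (fun s => F s * G s) = avg F * avg G.
Proof.
move=> AB hF hG.
pose k := sumA A F 1%g; pose N : R := #|[pred u : {perm V} | perm_on A u]|%:R.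
have N0 : N != 0.
  rewrite pnatr_eq0 -lt0n; apply/card_gt0P; exists 1%g; exact: perm_on1.
have key G' : (forall u s, perm_on A u -> G' (u * s)%g = G' s) ->
    N * avg (fun s => F s * G' s) = k * avg G'.
  move=> hG'; rewrite -[RHS]avgZ.
  transitivity (\sum_(u : {perm V} | perm_on A u) avg (fun s => F s * G' s)).
    by rewrite sumr_const /N mulr_natl.
  transitivity (\sum_(u : {perm V} | perm_on A u) avg (fun s => F (u * s)%g * G' s)).
    apply: eq_bigr => u uA; rewrite -(avg_mulg u); apply: eq_avg => s.
    by rewrite hG'.
  rewrite -avg_sum; apply: eq_avg => s.
  by rewrite -mulr_suml; congr (_ * _); exact: sumA_const.
have kF : N * avg F = k.
  rewrite -[RHS]mulr1 -(avg_cst (card_perm_gt0 n) 1) -key//.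
  by congr (_ * _); apply: eq_avg => s; rewrite mulr1.
suff h u s : perm_on A u -> G (u * s)%g = G s.
  by apply: (mulfI N0); rewrite key// -kF -[LHS]mulrA.
move=> uA; apply: hG => x y xB yB.
have fix_ z : z \in B -> u z = z.
  move=> zB; apply: (out_perm uA); apply/negP => /AB.
  by rewrite zB.
by rewrite !permM !fix_.
Qed.

Lemma order_determined_sub A B F :
  A \subset B -> order_determined A F -> order_determined B F.
Proof.
by move=> /fintype.subsetP AB hF s t h; apply: hF => x y /AB xB /AB yB; apply: h.
Qed.

Lemma order_determined_chord a b c d :
  order_determined [set a; b; c; d] (fun s => chord R s a b c d).
Proof.
move=> s t h; rewrite /chord; case: ifP => // _; congr (_%:R - _).
by rewrite /cross !h// !inE eqxx ?orbT.
Qed.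

End OrderDetermined.

(** * Covariances and counting *)

Section DartSums.
Context (R : realType) (n : nat).
Local Notation V := 'I_n.
Local Notation dart := (V * V)%type.
Local Notation quad := (dart * dart)%type.
Implicit Types (s t : {perm V}) (A : {set V}) (e f : dart) (q r : quad).

Definition ends q : {set V} := [set q.1.1; q.1.2; q.2.1; q.2.2].

Definition touch A e : bool := (e.1 \in A) || (e.2 \in A).

Definition meets q r : bool := touch (ends q) r.1 || touch (ends q) r.2.

Definition qchord s q : R := chord R s q.1.1 q.1.2 q.2.1 q.2.2.

Definition flip q : quad := (q.2, q.1).

Lemma qchord_flip s q : qchord s (flip q) = qchord s q.
Proof. exact: chordC. Qed.

Lemma ends_flip q : ends (flip q) = ends q.
Proof.
apply/setP => x; rewrite !inE /=.
by case: (x == q.1.1); case: (x == q.1.2); case: (x == q.2.1); case: (x == q.2.2).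
Qed.

Lemma card_ends q : (#|ends q| <= 4)%N.
Proof.
rewrite (leq_trans _ (card_size [:: q.1.1; q.1.2; q.2.1; q.2.2]))//.
by apply/subset_leq_card/fintype.subsetP => x; rewrite !inE -!orbA.
Qed.

Lemma meets_ends q r x : x \in ends q -> x \in ends r -> meets q r.
Proof.
move=> xq; rewrite {1}/ends !finset.in_setU !finset.in_set1 -!orbA /meets /touch.
by case/or4P => /eqP <-; rewrite xq ?orbT.
Qed.

Lemma meets_sym q r : meets q r = meets r q.
Proof.
by apply/idP/idP; rewrite {1}/meets /touch -!orbA => /or4P[] h;
  apply: meets_ends h; rewrite !inE eqxx ?orbT.
Qed.

Lemma qchord_fix t s q : {in ends q, t =1 id} -> qchord (t * s)%g q = qchord s q.
Proof.
move=> h; rewrite /qchord chord_mulg !h// !inE eqxx ?orbT//.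
Qed.

Lemma qchord_norm_le s q : `|qchord s q| <= 2 / 3.
Proof. exact: chord_norm_le. Qed.

Definition cov q r : R := avg (fun s => qchord s q * qchord s r).

Lemma cov_flip q r : cov (flip q) r = cov q r.
Proof. by apply: eq_avg => s; rewrite qchord_flip. Qed.

Lemma cov_sym q r : cov q r = cov r q.
Proof. by apply: eq_avg => s; rewrite mulrC. Qed.

Lemma cov_ge q r : - 1 <= cov q r.
Proof.
rewrite -[leLHS](avg_cst (card_perm_gt0 n)); apply: ler_avg => s.
have := qchord_norm_le s q; have := qchord_norm_le s r.
rewrite !ler_norml => /andP[h1 h2] /andP[h3 h4]; nra.
Qed.

(* The covariance of two crossing indicators sharing a single vertex
   vanishes, because crossing is invariant under cyclic rotations; here this
   takes the form of avg_chord_mul0, which moves all endpoints but one. *)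
Lemma cov_ge0 q r : ~~ touch (ends r) q.2 -> ~~ touch (ends q) r.2 ->
  0 <= cov q r.
Proof.
case: q r => [[a b] [c d]] [[a' b'] [c' d']]; rewrite /touch /=.
set q := ((a, b), (c, d)); set r := ((a', b'), (c', d')).
rewrite !negb_or => /andP[cr dr] /andP[c'q d'q].
have zero x y z w : (forall s, qchord s q = chord R s x y z w) ->
    y \notin ends r -> z \notin ends r -> w \notin ends r -> cov q r = 0.
  move=> e yr zr wr.
  have fix_ u v : u \notin ends r -> v \notin ends r -> {in ends r, tperm u v =1 id}.
    move=> ur vr k kr; apply: tpermD; [by apply: contraNneq ur => ->|].
    by apply: contraNneq vr => ->.
  rewrite /cov (eq_avg (H := fun s => chord R s x y z w * qchord s r)); last first.
    by move=> s; rewrite e.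
  by apply: avg_chord_mul0 => s; apply: qchord_fix; apply: fix_.
have [br|br] := boolP (b \in ends r); last by rewrite (@zero a b c d).
have [ar|ar] := boolP (a \in ends r); last first.
  by rewrite (@zero b a c d)// => s; rewrite -chordCl.
have [u|nu] := boolP (uniq [:: a; b; c; d]); last first.
  by rewrite /cov /avg big1 ?mul0r// => s _; rewrite /qchord /chord (negbTE nu) mul0r.
have [u'|nu'] := boolP (uniq [:: a'; b'; c'; d']); last first.
  by rewrite /cov /avg big1 ?mul0r// => s _; rewrite /qchord /chord (negbTE nu') mulr0.
(* Both [a] and [b] lie in [ends r] but differ from [c'] and [d'], so {a, b} = {a', b'}. *)
have er s : qchord s r = chord R s a b c' d'.
  move: ar br c'q d'q u; rewrite /qchord !inE /= !inE !negb_or -!andbA -!orbA.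
  case/or4P => /eqP-> /or4P[] /eqP->; rewrite ?eqxx ?andbF//= => _ _ _; exact: chordCl.
rewrite /cov (eq_avg (H := fun s => chord R s a b c d * chord R s a b c' d')); last first.
  by move=> s; rewrite er.
rewrite avg_chord_common_edge ?invr_ge0//.
move: cr dr c'q d'q u u'; rewrite /= !inE !negb_or -!andbA.
move=> /and4P[_ _ h1 h2] /and4P[_ _ h3 h4] /and4P[h5 h6 _ _] /and4P[h7 h8 _ _].
move=> /and5P[i1 i2 i3 i4 /and3P[i5 i6 _]] /and5P[_ _ _ _ /and3P[_ i7 _]].
by rewrite (eq_sym a c') (eq_sym a d') (eq_sym b c') (eq_sym b d')
  h1 h2 h3 h4 h5 h6 h7 h8 i1 i2 i3 i4 i5 i6 i7.
Qed.

(** Only a coincidence of the first edges with the same orientation is recorded; for a lower bound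
    of order M^3 this suffices. *)
Definition common_edge q r : bool :=
  (r.1 == q.1) && uniq [:: q.1.1; q.1.2; q.2.1; q.2.2; r.2.1; r.2.2].

Definition entangled q r : bool :=
  touch (ends q) r.1 && touch (ends q) r.2 || touch (ends r) q.1 && touch (ends r) q.2.

(** If [q] and [r] are not entangled, each has an edge that avoids the other; flips bring these
    edges to second position, where [cov_ge0] applies. Entangled pairs get the crude bound -1. *)
Lemma cov_lower q r :
  45^-1 * (common_edge q r)%:R - (entangled q r)%:R <= cov q r.
Proof.
have [/andP[/eqP e u]|nc] := boolP (common_edge q r).
  have -> : cov q r = 45^-1.
    rewrite -(avg_chord_common_edge R u); apply: eq_avg => s.
    by rewrite [in X in _ * X]/qchord e.
  by rewrite mulr1 gerBl.
rewrite mulr0 sub0r.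
have [_|] := boolP (entangled q r); first exact: cov_ge.
rewrite oppr0 negb_or !negb_and => /andP[/orP[] h1 /orP[] h2].
- rewrite -cov_flip cov_sym -cov_flip; apply: cov_ge0; rewrite ends_flip//.
- rewrite cov_sym -cov_flip cov_sym; apply: cov_ge0; rewrite ?ends_flip//.
- rewrite -cov_flip; apply: cov_ge0; rewrite ?ends_flip//.
- exact: cov_ge0.
Qed.

Context (D : {set dart}) (Delta : nat).
Hypothesis degD : forall x, (#|[set y | (x, y) \in D]%SET| <= Delta)%N.
Hypothesis symD : forall x y, (x, y) \in D -> (y, x) \in D.
Hypothesis irrD : forall x, (x, x) \notin D.

Local Notation M := (#|D|%:R : R).
Local Notation Dl := (Delta%:R : R).

Lemma sum_darts_const (c : R) : \sum_(e in D) c = M * c.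
Proof. by rewrite mulr_natl sumr_const. Qed.

Lemma sum_fst x : \sum_(e in D) (e.1 == x)%:R <= Dl.
Proof.
rewrite -natr_sum ler_nat (leq_trans _ (degD x))//.
have -> : (\sum_(e in D) (e.1 == x) = #|[set e in D | e.1 == x]|)%N.
  rewrite -sum1_card big_mkcond/= [RHS]big_mkcond/=.
  by apply: eq_bigr => e _; rewrite !inE; case: (e \in D); case: (e.1 == x).
rewrite (leq_trans _ (leq_imset_card (pair x) _))//.
apply/subset_leq_card/fintype.subsetP => -[u v]; rewrite !inE /= => /andP[uv /eqP ux].
by apply/imsetP; exists v; rewrite ?inE -?ux.
Qed.

Lemma sum_swap (F : dart -> R) : \sum_(e in D) F e = \sum_(e in D) F (e.2, e.1).
Proof.
rewrite (reindex_inj (h := fun e : dart => (e.2, e.1)))/=; last first.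
  by move=> [a b] [c d] [-> ->].
by apply: eq_bigl => -[a b] /=; apply/idP/idP; exact: symD.
Qed.

Lemma sum_touch A : \sum_(e in D) (touch A e)%:R <= 2 * Dl * #|A|%:R.
Proof.
apply: (@le_trans _ _ (\sum_(e in D) \sum_(x in A) ((e.1 == x)%:R + (e.2 == x)%:R))).
  apply: ler_sum => e _; rewrite /touch.
  have p x : 0 <= (e.1 == x)%:R + (e.2 == x)%:R :> R by rewrite addr_ge0.
  have [eA|eA] := boolP (e.1 \in A).
    by rewrite (bigD1 e.1)//= eqxx -addrA lerDl addr_ge0// sumr_ge0.
  have [eA'|eA'] := boolP (e.2 \in A); last by rewrite sumr_ge0.
  by rewrite (bigD1 e.2)//= eqxx addrC addrA lerDr addr_ge0// sumr_ge0.
have -> : 2 * Dl * #|A|%:R = \sum_(x in A) 2 * Dl by rewrite sumr_const mulr_natr.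
rewrite exchange_big/=; apply: ler_sum => x _.
rewrite big_split/= [X in _ + X]sum_swap/=.
by have := sum_fst x; lra.
Qed.

Definition quads : {set quad} := finset.setX D D.

Lemma sum_quads (F : quad -> R) :
  \sum_(q in quads) F q = \sum_(e in D) \sum_(f in D) F (e, f).
Proof.
rewrite pair_big/=; apply: eq_big => -[e f] //=.
by rewrite finset.in_setX.
Qed.

Lemma sum_quads_const (c : R) : \sum_(q in quads) c = M ^+ 2 * c.
Proof.
have -> : M ^+ 2 * c = (#|D| * #|D|)%N%:R * c by rewrite natrM.
by rewrite mulr_natl sumr_const cardsX.
Qed.

Lemma sum_quads_touch A :
  \sum_(q in quads) (touch A q.1 || touch A q.2)%:R <= 4 * Dl * M * #|A|%:R.
Proof.
rewrite sum_quads.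
apply: (@le_trans _ _ (\sum_(e in D) \sum_(f in D) ((touch A e)%:R + (touch A f)%:R))).
  apply: ler_sum => e _; apply: ler_sum => f _ /=.
  by case: (touch A e); case: (touch A f) => /=; lra.
under eq_bigr do rewrite big_split/= sum_darts_const.
rewrite big_split/= sum_darts_const -mulr_sumr.
set x := \sum_(e in D) _; have := ler_wpM2l (ler0n R #|D|) (sum_touch A).
rewrite -/x; lra.
Qed.

Lemma sum_meets q : \sum_(r in quads) (meets q r)%:R <= 16 * Dl * M.
Proof.
rewrite (le_trans (sum_quads_touch _))// (@le_trans _ _ (4 * Dl * M * 4))//.
  by rewrite ler_wpM2l ?mulr_ge0// (ler_nat _ _ 4) card_ends.
lra.
Qed.

Lemma sum_both_touch A : (#|A| <= 4)%N ->
  \sum_(q in quads) (touch A q.1 && touch A q.2)%:R <= (8 * Dl) ^+ 2.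
Proof.
move=> A4; rewrite sum_quads.
under eq_bigr => e _ do under eq_bigr => f _ do rewrite /= -mulnb natrM.
under eq_bigr do rewrite -mulr_sumr.
rewrite -mulr_suml expr2.
have h : \sum_(e in D) (touch A e)%:R <= 8 * Dl.
  rewrite (le_trans (sum_touch A))// (@le_trans _ _ (2 * Dl * 4))//.
    by rewrite ler_wpM2l ?mulr_ge0// (ler_nat _ _ 4).
  lra.
by apply: ler_pM => //; exact: sumr_ge0.
Qed.

Lemma sum_entangled :
  \sum_(q in quads) \sum_(r in quads) (entangled q r)%:R <= 128 * Dl ^+ 2 * M ^+ 2.
Proof.
have h : \sum_(q in quads) \sum_(r in quads)
    (touch (ends q) r.1 && touch (ends q) r.2)%:R <= (8 * Dl) ^+ 2 * M ^+ 2.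
  rewrite [leRHS]mulrC -sum_quads_const; apply: ler_sum => q _.
  by rewrite sum_both_touch// card_ends.
have h' := h; rewrite exchange_big/= in h'.
rewrite (_ : 128 * _ * _ = (8 * Dl) ^+ 2 * M ^+ 2 + (8 * Dl) ^+ 2 * M ^+ 2); last by ring.
apply: le_trans _ (lerD h h'); rewrite -big_split/=; apply: ler_sum => q _.
rewrite -big_split/=; apply: ler_sum => r _; rewrite /entangled.
by case: (touch _ _ && _); case: (touch _ _ && _) => /=; lra.
Qed.

(** Counts triples of pairwise disjoint oriented edges by a union bound: each of the three possible
    incidences removes at most 4 Delta M^2 triples. *)
Lemma sum_common_edge :
  M ^+ 3 - 12 * Dl * M ^+ 2 <=
  \sum_(q in quads) \sum_(r in quads) (common_edge q r)%:R.
Proof.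
have touch2 e : \sum_(f in D) (touch [set e.1; e.2] f)%:R <= 4 * Dl.
  rewrite (le_trans (sum_touch _))// (@le_trans _ _ (2 * Dl * 2))//; last by lra.
  rewrite ler_wpM2l ?mulr_ge0// (ler_nat _ _ 2).
  by rewrite cards2; case: (_ != _).
pose tt (e f : dart) : R := (touch [set e.1; e.2] f)%:R.
apply: (@le_trans _ _ (\sum_(e in D) \sum_(f in D) \sum_(f' in D)
    (1 - tt e f - tt e f' - tt f f'))).
  have -> : \sum_(e in D) \sum_(f in D) \sum_(f' in D) (1 - tt e f - tt e f' - tt f f') =
    M ^+ 3 - (\sum_(e in D) \sum_(f in D) tt e f) * M * 3.
    set x := \sum_(e in D) \sum_(f in D) tt e f.
    transitivity (\sum_(e in D) (M ^+ 2 - M * (\sum_(f in D) tt e f)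
        - M * (\sum_(f in D) tt e f) - x)).
      apply: eq_bigr => e _.
      transitivity (\sum_(f in D) (M - M * tt e f - \sum_(f' in D) tt e f' -
          \sum_(f' in D) tt f f')).
        by apply: eq_bigr => f _; rewrite !big_split/= !sumrN !sum_darts_const mulr1.
      by rewrite !big_split/= !sumrN !sum_darts_const -mulr_sumr -expr2.
    rewrite !big_split/= !sumrN !sum_darts_const -mulr_sumr -/x; ring.
  have : \sum_(e in D) \sum_(f in D) tt e f <= 4 * Dl * M.
    by rewrite [leRHS]mulrC -sum_darts_const; apply: ler_sum => e _; exact: touch2.
  have : 0 <= M by []. move: (\sum_(_ in _) _) => x. nra.
rewrite sum_quads; apply: ler_sum => e eD; apply: ler_sum => f fD.
apply: (@le_trans _ _ (\sum_(f' in D) (common_edge (e, f) (e, f'))%:R)); last first.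
  by rewrite sum_quads [leRHS](bigD1 e)//= lerDl; do 2!apply: sumr_ge0 => ? _.
apply: ler_sum => f' f'D; rewrite /common_edge eqxx /tt.
have red (b1 b2 b3 b : bool) : (~~ b1 -> ~~ b2 -> ~~ b3 -> b) ->
    1 - b1%:R - b2%:R - b3%:R <= b%:R :> R.
  case: b1; case: b2; case: b3; case: b => /= h; first [lra | by have := h isT isT isT].
apply: red => t1 t2 t3 /=.
have ne (x : dart) : x \in D -> x.1 != x.2.
  by case: x => x y; apply: contraTneq => /= ->; exact: irrD.
move: (ne _ eD) (ne _ fD) (ne _ f'D) t1 t2 t3.
rewrite /touch !inE /= ?inE !negb_or -!andbA.
rewrite !(eq_sym f.1) !(eq_sym f.2) !(eq_sym f'.1) !(eq_sym f'.2).
by move=> -> -> -> /and4P[-> -> -> ->] /and4P[-> -> -> ->] /and4P[-> -> -> ->].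
Qed.

End DartSums.

(** * Variance, jumps and drift of the crossing sum *)

Section CrossingSums.
Context (R : realType) (n : nat).
Local Notation V := 'I_n.
Local Notation dart := (V * V)%type.
Local Notation quad := (dart * dart)%type.
Implicit Types (s t : {perm V}) (q r : quad).

Definition pivot s q : R := chord R s q.1.1 q.2.1 q.1.2 q.2.2.

(** The contribution of [r] to the drift when the transposition attached to [q] is applied. *)
Definition theta q r s : R := 2 / 3 * pivot s q *
  (qchord R (tperm q.1.2 q.2.1 * s)%g r - qchord R s r).

Lemma tperm_ends q r : ~~ meets q r -> {in ends r, tperm q.1.2 q.2.1 =1 id}.
Proof.
move=> qr x xr; apply: tpermD; apply: contraNneq qr => e.
  by apply: meets_ends xr; rewrite -e !inE eqxx ?orbT.
by apply: meets_ends xr; rewrite -e !inE eqxx ?orbT.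
Qed.

Lemma theta_eq0 q r s : ~~ meets q r -> theta q r s = 0.
Proof. by move=> /tperm_ends h; rewrite /theta qchord_fix// subrr mulr0. Qed.

Lemma theta_bound q r s : `|theta q r s| <= 1.
Proof.
have h1 : `|pivot s q| <= 2 / 3 by exact: chord_norm_le.
have h2 := qchord_norm_le R (tperm q.1.2 q.2.1 * s)%g r.
have h3 := qchord_norm_le R s r.
rewrite /theta normrM (le_trans (ler_pM _ _ (_ : _ <= 4 / 9) (_ : _ <= 4 / 3)))//.
- by rewrite normrM ger0_norm; lra.
- by rewrite (le_trans (ler_normB _ _))//; lra.
- lra.
Qed.

(** The transposition attached to [q] preserves the union of the two vertex sets. *)
Lemma order_determined_theta q r :
  order_determined (ends q :|: ends r) (theta q r).
Proof.
move=> s t h; rewrite /theta.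
have sub (a b c d : V) : [set a; b; c; d]%SET \subset ends q :|: ends r ->
    chord R s a b c d = chord R t a b c d.
  move=> hA; have := order_determined_sub hA (@order_determined_chord R n a b c d).
  by apply.
have qA x : x \in ends q -> x \in ends q :|: ends r by rewrite !finset.in_setU => ->.
have tA x : x \in ends q :|: ends r ->
    tperm q.1.2 q.2.1 x \in ends q :|: ends r.
  by case: tpermP => // _ _; apply: qA; rewrite !inE eqxx ?orbT.
have sub4 (a b c d : V) (A : {set V}) : a \in A -> b \in A -> c \in A -> d \in A ->
    [set a; b; c; d]%SET \subset A.
  by move=> aA bA cA dA; apply/fintype.subsetP => x; rewrite !inE -!orbA =>
    /or4P[] /eqP->.
have rA x : x \in ends r -> x \in ends q :|: ends r.
  by rewrite !finset.in_setU => ->; rewrite orbT.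
have endsP (u : quad) :
    [/\ u.1.1 \in ends u, u.1.2 \in ends u, u.2.1 \in ends u & u.2.2 \in ends u].
  by rewrite !inE !eqxx ?orbT.
have [/qA q1 /qA q2 /qA q3 /qA q4] := endsP q.
have [/rA r1 /rA r2 /rA r3 /rA r4] := endsP r.
by rewrite /pivot /qchord !chord_mulg !sub//; apply: sub4 => //; apply: tA.
Qed.

Lemma meets_disjoint q r q' r' :
  ~~ [|| meets q q', meets q r', meets r q' | meets r r'] ->
  {in ends q :|: ends r, forall x, x \notin ends q' :|: ends r'}.
Proof.
move=> h x /finset.setUP hx; apply: contraNN h => /finset.setUP hx'.
by case: hx => hx; case: hx' => hx'; rewrite (meets_ends hx hx') ?orbT.
Qed.

(** The covariance vanishes if [q], [r] or [q'], [r'] do not meet, because a [theta] is then zero,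
    and also if the two vertex sets are disjoint, by independence. Otherwise it is at most 2 since
    |theta| <= 1. *)
Lemma cov_theta_le q r q' r' :
  avg (fun s => (theta q r s - avg (theta q r)) * (theta q' r' s - avg (theta q' r')))
  <= 2 * ((meets q r)%:R * (meets q' r')%:R *
    ((meets q q')%:R + (meets q r')%:R + (meets r q')%:R + (meets r r')%:R)).
Proof.
set m1 := avg (theta q r); set m2 := avg (theta q' r').
have U0 := card_perm_gt0 n.
have -> : avg (fun s => (theta q r s - m1) * (theta q' r' s - m2)) =
    avg (fun s => theta q r s * theta q' r' s) - m1 * m2.
  rewrite (eq_avg (H := fun s => theta q r s * theta q' r' s - m2 * theta q r s
     - m1 * theta q' r' s + m1 * m2)); last by move=> s; ring.
  by rewrite avgD (avg_cst U0) !avgB !avgZ -/m1 -/m2; ring.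
have norm1 a b : `|avg (theta a b)| <= 1.
  rewrite (le_trans (ler_norm_avg _))// -[leRHS](avg_cst U0).
  by apply: ler_avg => s; exact: theta_bound.
have zero a b : ~~ meets a b -> avg (theta a b) = 0.
  by move=> ab; rewrite /avg big1 ?mul0r// => s _; exact: theta_eq0.
have le2 : avg (fun s => theta q r s * theta q' r' s) - m1 * m2 <= 2.
  rewrite (_ : 2 = 1 + 1 :> R)// lerD//.
    rewrite -[leRHS](avg_cst U0); apply: ler_avg => s.
    rewrite (le_trans (ler_norm _))// normrM mulr_ile1 ?theta_bound//.
  by rewrite (le_trans (ler_norm _))// normrN normrM mulr_ile1 ?norm1.
have [qr|qr] := boolP (meets q r); last first.
  rewrite /m1 zero// mul0r subr0 mul0r mul0r mulr0.
  by rewrite /avg big1 ?mul0r// => s _; rewrite theta_eq0// mul0r.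
have [qr'|qr'] := boolP (meets q' r'); last first.
  rewrite /m2 zero// mulr0 subr0 mulr0 mul0r mulr0.
  by rewrite /avg big1 ?mul0r// => s _; rewrite (theta_eq0 _ qr') mulr0.
rewrite !mul1r.
have [|h] := boolP [|| meets q q', meets q r', meets r q' | meets r r'].
  move=> h; rewrite (le_trans le2)// ler_peMr//.
  by case/or4P: h => ->; do ?case: (meets _ _) => /=; lra.
rewrite (avg_mul_disjoint (meets_disjoint h)); last 2 first.
- exact: order_determined_theta.
- exact: order_determined_theta.
by rewrite subrr mulr_ge0// !addr_ge0.
Qed.

Context (D : {set dart}) (Delta : nat).
Hypothesis degD : forall x, (#|[set y | (x, y) \in D]%SET| <= Delta)%N.
Hypothesis symD : forall x y, (x, y) \in D -> (y, x) \in D.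
Hypothesis irrD : forall x, (x, x) \notin D.

Local Notation M := (#|D|%:R : R).
Local Notation Dl := (Delta%:R : R).
Local Notation Q := (quads D).

Definition centered s : R := \sum_(q in Q) qchord R s q.

Definition cvar : R := avg (fun s => centered s ^+ 2).

Lemma cvar_lower : (M ^+ 3 - 12 * Dl * M ^+ 2) / 45 - 128 * Dl ^+ 2 * M ^+ 2 <= cvar.
Proof.
have -> : cvar = \sum_(q in Q) \sum_(r in Q) cov R q r.
  rewrite /cvar (eq_avg (H := fun s => \sum_(q in Q) \sum_(r in Q)
      qchord R s q * qchord R s r)).
    by rewrite avg_sum; apply: eq_bigr => q _; rewrite avg_sum.
  by move=> s; rewrite expr2 /centered mulr_suml; apply: eq_bigr => q _; rewrite mulr_sumr.
have h1 := sum_common_edge R degD symD irrD.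
have h2 := sum_entangled R degD symD.
apply: (@le_trans _ _ (\sum_(q in Q) \sum_(r in Q)
    (45^-1 * (common_edge q r)%:R - (entangled q r)%:R))); last first.
  by apply: ler_sum => q _; apply: ler_sum => r _; exact: cov_lower.
under eq_bigr do rewrite big_split/= sumrN -mulr_sumr.
rewrite big_split/= sumrN -mulr_sumr; lra.
Qed.

Lemma centered_jump b c s :
  `|centered (tperm b c * s)%g - centered s| <= 11 * Dl * M.
Proof.
rewrite /centered -sumrB (le_trans (ler_norm_sum _ _ _))//.
(* Only terms touching {b, c} change, each by at most 4/3. There are at most 8 Delta M of them, and
   32/3 <= 11. *)
apply: (@le_trans _ _ (\sum_(q in Q)
    4 / 3 * (touch [set b; c] q.1 || touch [set b; c] q.2)%:R)).
  apply: ler_sum => q _.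
  have h2 := qchord_norm_le R (tperm b c * s)%g q.
  have h3 := qchord_norm_le R s q.
  have [_|nt] := boolP (touch _ _ || _).
    by rewrite mulr1 (le_trans (ler_normB _ _))//; lra.
  rewrite qchord_fix ?subrr ?normr0 ?mulr0// => x xq.
  apply: tpermD; apply: contraNneq nt => e; move: xq;
    by rewrite -e /ends !inE -!orbA /touch !inE => /or4P[] /eqP <-; rewrite eqxx ?orbT.
rewrite -mulr_sumr.
have h := sum_quads_touch R degD symD [set b; c]%SET.
have h2 : 4 * Dl * M * #|[set b; c]%SET|%:R <= 4 * Dl * M * 2.
  by rewrite ler_wpM2l ?mulr_ge0// (ler_nat _ _ 2) cards2; case: (_ != _).
have h3 : 0 <= Dl * M by rewrite mulr_ge0.
lra.
Qed.

Lemma sum_quads_swap (F : quad -> R) :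
  \sum_(q in Q) F q = \sum_(q in Q) F (q.1, (q.2.2, q.2.1)).
Proof. by rewrite !sum_quads; apply: eq_bigr => e _; rewrite (sum_swap symD). Qed.

Lemma centered_ibp (F : {perm V} -> R) :
  avg (fun s => centered s * F s) =
  avg (fun s => \sum_(q in Q) 2 / 3 * pivot s q * (F (tperm q.1.2 q.2.1 * s)%g - F s)).
Proof.
pose G q := avg (fun s => pivot s q * (F (tperm q.1.2 q.2.1 * s)%g - F s)).
transitivity (\sum_(q in Q) 2 / 3 * G q).
  rewrite (eq_avg (H := fun s => \sum_(q in Q) qchord R s q * F s)); last first.
    by move=> s; rewrite mulr_suml.
  rewrite avg_sum.
  under eq_bigr do rewrite /qchord chord_ibp.
  (* Reversing the second edge turns the exchange of b and d into that of b and c, so the two thirds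
     given by [chord_ibp] merge into 2/3. *)
  rewrite big_split/= [X in _ + X = _]sum_quads_swap -big_split/=.
  apply: eq_bigr => q _; rewrite /G /pivot.
  rewrite [X in _ + _ * X = _](eq_avg (H := fun s => pivot s q * (F (tperm q.1.2 q.2.1 * s)%g - F s))).
    by rewrite /pivot; lra.
  by move=> s; rewrite /pivot chordCr.
rewrite avg_sum; apply: eq_bigr => q _; rewrite -avgZ.
by apply: eq_avg => s; rewrite mulrA.
Qed.

Definition drift s : R :=
  \sum_(q in Q) 2 / 3 * pivot s q * (centered (tperm q.1.2 q.2.1 * s)%g - centered s).

Lemma driftE s : drift s = \sum_(q in Q) \sum_(r in Q) theta q r s.
Proof.
apply: eq_bigr => q _; rewrite /centered -sumrB mulr_sumr.
by apply: eq_bigr => r _.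
Qed.

Lemma avg_drift : avg drift = cvar.
Proof.
by rewrite /cvar -centered_ibp; apply: eq_avg => s; rewrite expr2.
Qed.

(** The incidences form a tree rooted at [q]: there are M^2 choices of [q], and each further
    quadruple meets one already chosen. *)
Lemma sum_meets4 : \sum_(q in Q) \sum_(r in Q) \sum_(q' in Q) \sum_(r' in Q)
   (meets q r)%:R * (meets q' r')%:R * (meets q q')%:R <=
   M ^+ 2 * (16 * Dl * M) ^+ 3.
Proof.
have L0 : 0 <= 16 * Dl * M by rewrite !mulr_ge0.
rewrite -sum_quads_const; apply: ler_sum => q _.
under eq_bigr => r _ do under eq_bigr => q' _ do
  (under eq_bigr => r' _ do rewrite mulrAC; rewrite -mulr_sumr).
apply: (@le_trans _ _ (\sum_(r in Q) \sum_(q' in Q)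
   (meets q r)%:R * ((meets q q')%:R * (16 * Dl * M)))).
  apply: ler_sum => r _; apply: ler_sum => q' _; rewrite mulrA ler_wpM2l ?mulr_ge0//.
  exact: sum_meets.
under eq_bigr do rewrite -mulr_sumr -mulr_suml.
rewrite -mulr_suml exprS expr2.
apply: ler_pM; rewrite ?mulr_ge0 ?sumr_ge0//; first exact: sum_meets.
by rewrite ler_wpM2r//; exact: sum_meets.
Qed.

(** Expanding the square, [cov_theta_le] gives four incidence patterns with coefficient 2. Symmetry
    of [meets] and reordering of sums reduce each pattern to [sum_meets4]. *)
Lemma drift_variance :
  avg (fun s => (drift s - cvar) ^+ 2) <= 8 * (M ^+ 2 * (16 * Dl * M) ^+ 3).
Proof.
pose th q r s := theta q r s - avg (theta q r).
have e s : drift s - cvar = \sum_(q in Q) \sum_(r in Q) th q r s.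
  rewrite driftE -avg_drift (eq_avg driftE) avg_sum -sumrB.
  by apply: eq_bigr => q _; rewrite avg_sum -sumrB.
rewrite (eq_avg (H := fun s => \sum_(q in Q) \sum_(r in Q) \sum_(q' in Q) \sum_(r' in Q)
   th q r s * th q' r' s)); last first.
  move=> s; rewrite e expr2 mulr_suml; apply: eq_bigr => q _.
  rewrite mulr_suml; apply: eq_bigr => r _.
  by rewrite mulr_sumr; apply: eq_bigr => q' _; rewrite mulr_sumr.
rewrite avg_sum; under eq_bigr do rewrite avg_sum.
under eq_bigr do under eq_bigr do rewrite avg_sum.
under eq_bigr do under eq_bigr do under eq_bigr do rewrite avg_sum.
pose m q r : R := (meets q r)%:R.
apply: (@le_trans _ _ (\sum_(q in Q) \sum_(r in Q) \sum_(q' in Q) \sum_(r' in Q)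
    (2 * (m q r * m q' r' * m q q') + 2 * (m q r * m q' r' * m q r') +
     2 * (m q r * m q' r' * m r q') + 2 * (m q r * m q' r' * m r r')))).
  do 4!(apply: ler_sum => ? _).
  by rewrite (le_trans (cov_theta_le _ _ _ _))// /m; lra.
pose S4 (F : quad -> quad -> quad -> quad -> R) :=
  \sum_(q in Q) \sum_(r in Q) \sum_(q' in Q) \sum_(r' in Q) F q r q' r'.
have S4D F G : S4 (fun q r q' r' => F q r q' r' + G q r q' r') = S4 F + S4 G.
  rewrite /S4 -big_split/=; apply: eq_bigr => ? _; rewrite -big_split/=.
  apply: eq_bigr => ? _; rewrite -big_split/=.
  by apply: eq_bigr => ? _; rewrite -big_split.
have S4Z (c : R) F : S4 (fun q r q' r' => c * F q r q' r') = c * S4 F.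
  rewrite /S4 mulr_sumr; apply: eq_bigr => ? _; rewrite mulr_sumr.
  by apply: eq_bigr => ? _; rewrite mulr_sumr; apply: eq_bigr => ? _; rewrite mulr_sumr.
have sw1 F : S4 F = S4 (fun q r => F r q) by rewrite /S4 exchange_big.
have sw2 F : S4 F = S4 (fun q r q' r' => F q r r' q').
  by rewrite /S4; apply: eq_bigr => ? _; apply: eq_bigr => ? _; rewrite exchange_big.
have ms q r : m q r = m r q by rewrite /m meets_sym.
have eS F G : (forall q r q' r', F q r q' r' = G q r q' r') -> S4 F = S4 G.
  by move=> h; do 4!(apply: eq_bigr => ? _).
have := sum_meets4; rewrite -/(S4 (fun q r q' r' => m q r * m q' r' * m q q')).
set X := S4 _ => hX; rewrite -/(S4 (fun q r q' r' => _)) !S4D !S4Z.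
have -> : S4 (fun q r q' r' => m q r * m q' r' * m q r') = X.
  by rewrite sw2; apply: eS => q r q' r'; rewrite (ms r' q').
have -> : S4 (fun q r q' r' => m q r * m q' r' * m r q') = X.
  by rewrite sw1; apply: eS => q r q' r'; rewrite (ms r q).
have -> : S4 (fun q r q' r' => m q r * m q' r' * m r r') = X.
  by rewrite sw1 sw2; apply: eS => q r q' r'; rewrite (ms r q) (ms r' q').
rewrite -/X; lra.
Qed.

End CrossingSums.

(** * Normal approximation for the normalized crossing sum *)

Section CrossingNormal.
Context (R : realType) (n : nat).
Local Notation V := 'I_n.
Local Notation dart := (V * V)%type.
Local Notation quad := (dart * dart)%type.
Context (D : {set dart}) (Delta : nat).
Hypothesis degD : forall x, (#|[set y | (x, y) \in D]%SET| <= Delta)%N.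
Hypothesis symD : forall x y, (x, y) \in D -> (y, x) \in D.
Hypothesis irrD : forall x, (x, x) \notin D.

Local Notation M := (#|D|%:R : R).
Local Notation Dl := (Delta%:R : R).
Local Notation Q := (quads D).
Local Notation Y := (centered R D).

(** Above it, the error terms of [cvar_lower], at most 129 Delta^2 M^2 together, take away at most
    half of the main term M^3 / 45. *)
Definition dart_threshold : R := (90 * 129) * Dl ^+ 2.

Hypothesis Delta0 : (0 < Delta)%N.
Hypothesis D0 : (0 < #|D|)%N.
Hypothesis Dbig : dart_threshold <= M.

Let Dl1 : 1 <= Dl. Proof. by rewrite ler1n. Qed.
Let M0 : 0 < M. Proof. by rewrite ltr0n. Qed.

Lemma cvar_cube : M ^+ 3 / 90 <= cvar R D.
Proof.
apply: le_trans (cvar_lower R degD symD irrD).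
have h : (90 * 129) * Dl ^+ 2 * M ^+ 2 <= M * M ^+ 2.
  by rewrite ler_wpM2r// exprn_ge0// ltW.
have h2 : Dl * M ^+ 2 <= Dl ^+ 2 * M ^+ 2.
  by rewrite ler_wpM2r ?exprn_ge0 ?(ltW M0)// expr2 ler_peMl.
have h3 : 0 <= Dl ^+ 2 * M ^+ 2 by rewrite mulr_ge0// exprn_ge0.
rewrite -exprS in h; lra.
Qed.

Let S := cvar R D.
Let x := Num.sqrt M.
Let sg := Num.sqrt S.

Let x0 : 0 < x. Proof. by rewrite sqrtr_gt0. Qed.
Let x2 : x ^+ 2 = M. Proof. by rewrite sqr_sqrtr// ltW. Qed.

Lemma cvar_gt0 : 0 < cvar R D.
Proof. by apply: lt_le_trans cvar_cube; rewrite divr_gt0// exprn_gt0. Qed.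

Let sg0 : 0 < sg. Proof. by rewrite sqrtr_gt0 cvar_gt0. Qed.
Let sg2 : sg ^+ 2 = S. Proof. by rewrite sqr_sqrtr// ltW// cvar_gt0. Qed.

(** Rounding the square root of 90 up to 10 keeps the constants below rational. *)
Let sg_ge : x ^+ 3 / 10 <= sg.
Proof.
rewrite -(@ler_pXn2r _ 2)// ?nnegrE ?(ltW sg0)//; last first.
  by rewrite divr_ge0// exprn_ge0// ltW.
rewrite sg2; apply: le_trans cvar_cube.
rewrite (_ : (x ^+ 3 / 10) ^+ 2 = (x ^+ 2) ^+ 3 / 100); last by field.
have : 0 <= M ^+ 3 by rewrite exprn_ge0// ltW.
by rewrite x2; lra.
Qed.

Let W s := Y s / sg.
Let W' (q : quad) s := W (tperm q.1.2 q.2.1 * s)%g.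
(** Extended by 0 because the coupling is indexed by a whole finite type. *)
Let g (q : quad) s := if q \in Q then 2 / 3 * pivot R s q / sg else 0.

Let sum_g (F : quad -> R) s :
  \sum_q g q s * F q = sg^-1 * \sum_(q in Q) 2 / 3 * pivot R s q * F q.
Proof.
rewrite mulr_sumr [RHS]big_mkcond/=; apply: eq_bigr => q _; rewrite /g.
by case: ifP => _; [ring|rewrite mul0r].
Qed.

Let coupling (f : R -> R) : avg (fun s => W s * f (W s)) =
  avg (fun s => \sum_q g q s * (f (W' q s) - f (W s))).
Proof.
rewrite (eq_avg (H := fun s => sg^-1 * (Y s * f (W s)))); last first.
  by move=> s; rewrite /W; ring.
rewrite avgZ (centered_ibp symD (fun s => f (W s))) -avgZ.
by apply: eq_avg => s; rewrite sum_g.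
Qed.

(** The jump 11 Delta M is divided by [sg >= x ^+ 3 / 10], where M = x^2. *)
Let jump q s : `|W' q s - W s| <= 110 * Dl / x.
Proof.
rewrite /W' /W -mulrBl normrM normfV (gtr0_norm sg0) ler_pdivrMr//.
apply: le_trans (centered_jump R degD symD _ _ _) _.
apply: (@le_trans _ _ (110 * Dl / x * (x ^+ 3 / 10))).
  by rewrite -x2 le_eqVlt; apply/orP; left; apply/eqP; field; rewrite gt_eqF.
by rewrite ler_wpM2l// !mulr_ge0// invr_ge0 ltW.
Qed.

Let weight s : \sum_q `|g q s| <= 10 * x.
Proof.
apply: (@le_trans _ _ (\sum_(q in Q) 4 / 9 / sg)).
  rewrite [leRHS]big_mkcond/=; apply: ler_sum => q _; rewrite /g.
  case: ifP => _; last by rewrite normr0.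
  rewrite normrM normfV (gtr0_norm sg0) ler_wpM2r ?invr_ge0 ?(ltW sg0)//.
  have : `|pivot R s q| <= 2 / 3 by exact: chord_norm_le.
  by rewrite normrM ger0_norm; lra.
rewrite sum_quads_const mulrA ler_pdivrMr//.
apply: (@le_trans _ _ (10 * x * (x ^+ 3 / 10))).
  rewrite -x2 [leRHS](_ : _ = (x ^+ 2) ^+ 2); last by field.
  by have := sqr_ge0 (x ^+ 2); lra.
by rewrite ler_wpM2l// mulr_ge0// ltW.
Qed.

Let variance : avg (fun s => W s ^+ 2) = 1.
Proof.
rewrite (eq_avg (H := fun s => S^-1 * (Y s ^+ 2))); last first.
  by move=> s; rewrite /W expr_div_n sg2 mulrC.
by rewrite avgZ mulVf// gt_eqF// cvar_gt0.
Qed.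

(** Divides [drift_variance] by S^2 >= (M^3 / 90)^2. Since 16^3 = 64^2, enlarging 8 to 3^2 and
    Delta^3 to Delta^4 makes the bound a perfect square. *)
Let driftW : avg (fun s => (\sum_q g q s * (W' q s - W s) - 1) ^+ 2) <=
  ((90 * (3 * 64)) * Dl ^+ 2 / x) ^+ 2.
Proof.
have S0 := cvar_gt0; have nS : S != 0 by rewrite gt_eqF.
have nsg : sg != 0 by rewrite gt_eqF.
rewrite (eq_avg (H := fun s => S ^- 2 * (drift R D s - S) ^+ 2)); last first.
  move=> s; rewrite sum_g.
  have -> : \sum_(q in Q) 2 / 3 * pivot R s q * (W' q s - W s) = drift R D s / sg.
    by rewrite /drift mulr_suml; apply: eq_bigr => q _; rewrite /W' /W -mulrBl; ring.
  rewrite -sg2; field; exact: nsg.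
rewrite avgZ.
have h := drift_variance R degD symD.
apply: le_trans (ler_wpM2l _ h) _; first by rewrite invr_ge0 sqr_ge0.
rewrite mulrC ler_pdivrMr ?exprn_gt0//.
have hS : (M ^+ 3 / 90) ^+ 2 <= S ^+ 2.
  have h0 : 0 <= M ^+ 3 / 90 by rewrite divr_ge0// exprn_ge0// ltW.
  by rewrite !expr2; apply: ler_pM => //; exact: cvar_cube.
apply: (@le_trans _ _ (((90 * (3 * 64)) * Dl ^+ 2 / x) ^+ 2 * (M ^+ 3 / 90) ^+ 2)); last first.
  by rewrite ler_wpM2l ?sqr_ge0.
rewrite expr_div_n x2.
rewrite [leRHS](_ : _ = 9 * (64 ^+ 2 * (Dl * Dl ^+ 3) * M ^+ 5)); last first.
  by field; rewrite gt_eqF.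
rewrite [leLHS](_ : _ = 8 * (64 ^+ 2 * Dl ^+ 3 * M ^+ 5)); last by ring.
have h3 : 0 <= 64 ^+ 2 * Dl ^+ 3 * M ^+ 5 by rewrite !mulr_ge0 ?exprn_ge0.
apply: (@le_trans _ _ (9 * (64 ^+ 2 * Dl ^+ 3 * M ^+ 5))).
  by rewrite ler_wpM2r// ler_nat.
rewrite ler_wpM2l// ler_wpM2r ?exprn_ge0// ler_wpM2l ?exprn_ge0//.
by rewrite ler_peMl// exprn_ge0.
Qed.

(** This is [stein_const] times [x] for a = 10 x, b = 110 Delta / x and psi = 90 * 192 * Delta^2 /
    x; the product a b does not depend on [x]. *)
Definition crossing_const (k : R) : R :=
  2 * ((90 * (3 * 64)) * Dl ^+ 2) + 11 * 100 * Dl * (110 * Dl * (stein_bound k + 2) +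
    32 * (110 * Dl * (110 * 100 * Dl + 1) + (90 * (3 * 64)) * Dl ^+ 2)).

Lemma centered_normal k Phi z : 0 < k -> normal_like k Phi ->
  `|avg (fun s => (Y s / Num.sqrt (cvar R D) <= z)%R%:R) - Phi z| <=
  crossing_const k / Num.sqrt M.
Proof.
move=> k0 hPhi.
have b0 : 0 < 110 * Dl / x by rewrite divr_gt0// mulr_gt0// (lt_le_trans _ Dl1).
have p0 : 0 < (90 * (3 * 64)) * Dl ^+ 2 / x.
  by rewrite divr_gt0// mulr_gt0// exprn_gt0// (lt_le_trans _ Dl1).
have a0 : 0 < 10 * x by rewrite mulr_gt0.
have := stein_coupling (card_perm_gt0 n) a0 b0 p0 coupling jump weight variance
  driftW z k0 hPhi.
congr (_ <= _); rewrite /stein_const /crossing_const -/x.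
by field; rewrite gt_eqF.
Qed.

End CrossingNormal.

(** * From graphs to darts *)

Section GraphDarts.
Context (R : realType) (n : nat) (G : sgraph n).
Local Notation V := 'I_n.
Implicit Types (s : {perm V}).

Definition darts : {set V * V} := [set e | adj G e.1 e.2].

Lemma in_darts x y : ((x, y) \in darts) = adj G x y.
Proof. by rewrite inE. Qed.

Lemma adjC x y : adj G x y = adj G y x.
Proof. by rewrite /adj finset.setUC. Qed.

Lemma darts_sym x y : (x, y) \in darts -> (y, x) \in darts.
Proof. by rewrite !in_darts adjC. Qed.

Lemma card_edge e : e \in edges G -> #|e| = 2%N.
Proof. by case: G => E /= /forall_inP h /h/eqP. Qed.

Lemma darts_irr x : (x, x) \notin darts.
Proof.
by rewrite in_darts; apply/negP => /card_edge; rewrite finset.setUid cards1.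
Qed.

Lemma darts_degree Delta : (max_degree G <= Delta)%N ->
  forall x, (#|[set y | (x, y) \in darts]%SET| <= Delta)%N.
Proof.
move=> h x; apply: leq_trans h; rewrite (eq_card (B := [set y | adj G x y]%SET)).
  exact: (leq_bigmax (F := fun v => degree G v)).
by move=> y; rewrite !inE.
Qed.

Lemma num_edges_le : (num_edges G <= #|darts|)%N.
Proof.
rewrite /num_edges (leq_trans _ (leq_imset_card (fun e : V * V => [set e.1; e.2]%SET) _))//.
apply/subset_leq_card/fintype.subsetP => e eG.
have /cards2P[x [y [_ exy]]] : #|e| == 2%N by rewrite card_edge.
by apply/imsetP; exists (x, y); rewrite ?in_darts ?/adj -?exy.
Qed.

Let kappa s (a b c d : V) : R := [&& s c < s a, s b < s c & s d < s b]%N%:R.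

Let sumD (F : V -> V -> V -> V -> R) : R :=
  \sum_(e in darts) \sum_(f in darts) F e.1 e.2 f.1 f.2.

Let sum_l F : sumD (fun a b c d => F b a c d) = sumD F.
Proof. by rewrite /sumD [RHS](sum_swap darts_sym). Qed.

Let sum_r F : sumD (fun a b c d => F a b d c) = sumD F.
Proof. by rewrite /sumD; apply: eq_bigr => e _; rewrite [RHS](sum_swap darts_sym). Qed.

Let sum_c F : sumD (fun a b c d => F c d a b) = sumD F.
Proof. by rewrite /sumD exchange_big. Qed.

(** Reversing either chord or exchanging the two gives eight labelings of a pair of chords; a
    crossing pair satisfies the ordering in [crossing] for exactly one of them. *)
Let cross_kappa s (a b c d : V) :
  (uniq [:: a; b; c; d] && cross (s a) (s b) (s c) (s d))%:R =
  kappa s a b c d + kappa s b a c d + (kappa s a b d c + kappa s b a d c) +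
  (kappa s c d a b + kappa s c d b a + (kappa s d c a b + kappa s d c b a)).
Proof.
rewrite -(uniq_perm_val s [:: a; b; c; d]) /kappa -!natrD; congr (_%:R).
rewrite /= !inE !negb_or -!andbA /cross.
move: (val (s a)) (val (s b)) (val (s c)) (val (s d)) => x y z w.
case: (ltngtP x y) => xy; case: (ltngtP x z) => xz; case: (ltngtP x w) => xw;
case: (ltngtP y z) => yz; case: (ltngtP y w) => yw; case: (ltngtP z w) => zw //=;
exfalso; lia.
Qed.

Lemma num_crossingsE s : (num_crossings G s)%:R = sumD (kappa s).
Proof.
rewrite /num_crossings -sum1_card natr_sum big_mkcond/=.
pose h (p : (V * V) * (V * V)) := (p.1.1, p.1.2, p.2.1, p.2.2).
pose h' (q : V * V * V * V) := ((q.1.1.1, q.1.1.2), (q.1.2, q.2)).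
have hb : bijective h by exists h'; [move=> [[a b] [c d]]|move=> [[[a b] c] d]].
rewrite (reindex h); last exact: onW_bij.
rewrite /sumD pair_big/= [RHS]big_mkcond/=.
apply: eq_bigr => -[[a b] [c d]] _ /=; rewrite !inE /= /kappa.
by case: (adj G a b); case: (adj G c d) => //=;
  case: (s c < s a)%N; case: (s b < s c)%N; case: (s d < s b)%N.
Qed.

(** The eight terms of [cross_kappa] have equal sums because the set of darts is symmetric. The
    added sum is independent of [s]. *)
Lemma crossings_centered s : 8 * (num_crossings G s)%:R =
  centered R darts s + sumD (fun a b c d => 3^-1 * (uniq [:: a; b; c; d])%:R).
Proof.
have -> : centered R darts s + sumD (fun a b c d => 3^-1 * (uniq [:: a; b; c; d])%:R) =
    sumD (fun a b c d => (uniq [:: a; b; c; d] && cross (s a) (s b) (s c) (s d))%:R).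
  rewrite /centered sum_quads /sumD -big_split/=; apply: eq_bigr => e _.
  rewrite -big_split/=; apply: eq_bigr => f _; rewrite /qchord /chord /=.
  case: ifP => _ /=; last by rewrite mulr0 addr0.
  by rewrite mulr1 subrK.
have sumDD F H : sumD (fun a b c d => F a b c d + H a b c d) = sumD F + sumD H.
  by rewrite /sumD -big_split/=; apply: eq_bigr => e _; rewrite -big_split.
have eqD F H : (forall a b c d, F a b c d = H a b c d) -> sumD F = sumD H.
  by move=> h; apply: eq_bigr => e _; apply: eq_bigr.
rewrite (eqD _ _ (fun a b c d => cross_kappa s a b c d)) !sumDD num_crossingsE.
set N := sumD (kappa s).
have e1 : sumD (fun a b c d => kappa s b a c d) = N by exact: sum_l.
have e2 : sumD (fun a b c d => kappa s a b d c) = N by exact: sum_r.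
have e3 : sumD (fun a b c d => kappa s b a d c) = N.
  by rewrite -e2 -(sum_l (fun a b c d => kappa s a b d c)).
have e4 : sumD (fun a b c d => kappa s c d a b) = N by exact: sum_c.
have e5 : sumD (fun a b c d => kappa s c d b a) = N.
  by rewrite -e2 -(sum_c (fun a b c d => kappa s a b d c)).
have e6 : sumD (fun a b c d => kappa s d c a b) = N.
  by rewrite -e1 -(sum_c (fun a b c d => kappa s b a c d)).
have e7 : sumD (fun a b c d => kappa s d c b a) = N.
  by rewrite -e3 -(sum_c (fun a b c d => kappa s b a d c)).
rewrite -/N e1 e2 e3 e4 e5 e6 e7; ring.
Qed.

Lemma avg_centered : avg (centered R darts) = 0.
Proof.
by rewrite avg_sum big1// => q _; exact: avg_chord.
Qed.

Definition crossings s : R := (num_crossings G s)%:R.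

Lemma crossings_sub_mean s : crossings s - avg crossings = centered R darts s / 8.
Proof.
set c := sumD (fun a b c d => 3^-1 * (uniq [:: a; b; c; d])%:R).
have e u : crossings u = 8^-1 * centered R darts u + c / 8.
  by have := crossings_centered u; rewrite -/c /crossings; lra.
have -> : avg crossings = c / 8.
  by rewrite (eq_avg e) avgD (avg_cst (card_perm_gt0 n)) avgZ avg_centered mulr0 add0r.
rewrite e; lra.
Qed.

Lemma crossings_variance :
  avg (fun s => (crossings s - avg crossings) ^+ 2) = cvar R darts / 64.
Proof.
rewrite /cvar mulrC -avgZ; apply: eq_avg => s.
by rewrite crossings_sub_mean; field.
Qed.

Lemma crossings_normal Delta k Phi x : 0 < k -> normal_like k Phi ->
  (0 < Delta)%N -> (0 < num_edges G)%N -> (max_degree G <= Delta)%N ->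
  dart_threshold R Delta <= #|darts|%:R ->
  let v := avg (fun s => (crossings s - avg crossings) ^+ 2) in
  0 < v /\
  `|avg (fun s => (crossings s <= x)%R%:R) - Phi ((x - avg crossings) / Num.sqrt v)|
    <= crossing_const Delta k / Num.sqrt #|darts|%:R.
Proof.
move=> k0 hPhi D0 e0 deg big v.
have degD := darts_degree deg.
have card0 : (0 < #|darts|)%N by apply: leq_trans num_edges_le.
have S0 : 0 < cvar R darts := cvar_gt0 degD darts_sym darts_irr D0 card0 big.
have v0 : 0 < v by rewrite /v crossings_variance divr_gt0.
split=> //.
have := centered_normal degD darts_sym darts_irr D0 card0 big
  ((x - avg crossings) / Num.sqrt v) k0 hPhi.
congr (`|_ - _| <= _); apply: eq_avg => s; congr (_%:R).
have -> : Num.sqrt (cvar R darts) = 8 * Num.sqrt v.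
  rewrite (_ : cvar R darts = 8 ^+ 2 * v); last by rewrite /v crossings_variance; field.
  by rewrite sqrtrM ?sqr_ge0// sqrtr_sqr ger0_norm.
have sv0 : 0 < Num.sqrt v by rewrite sqrtr_gt0.
congr (nat_of_bool _); rewrite -[RHS](lerD2r (- avg crossings)) crossings_sub_mean.
by rewrite invfM mulrA ler_pM2r ?invr_gt0.
Qed.

End GraphDarts.

(** * The normal distribution function *)

Section NormalCdf.
Context (R : realType) (mu sg : R).
Hypothesis sg0 : 0 < sg.
Local Open Scope measure_display_scope.

Let F (y : R) : R := fine (normal_prob mu sg `]-oo, y]).

Let d_F (y : R) : is_derive y 1 F (normal_pdf mu sg y).
Proof.
(* The endpoint [y + 1] serves to place [y] inside the interval of integration. *)
have [||||h1 h2] := @continuous_FTC1 R (normal_pdf mu sg) -oo%O y (y + 1).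
- by rewrite ltrDl.
- by apply: (@integrableS _ _ _ _ setT) => //; apply: integrable_normal_pdf.
- by rewrite ltNyr.
- by apply: continuous_normal_pdf; rewrite gt_eqF.
apply: DeriveDef; first exact: h1.
rewrite -derive1E; exact: h2.
Qed.

(** As a random variable under the normal law, the identity has distribution function F, so the
    limits of a [cdf] at infinity apply. *)
Let idR : measurableTypeR R -> R := idfun.

#[local] HB.instance Definition _ :=
  @isMeasurableFun.Build _ _ _ _ idR (@measurable_id _ _ setT).

Let F01 y : 0 <= F y <= 1.
Proof.
have f : normal_prob mu sg `]-oo, y] \is a fin_num by exact: fin_num_measure.
by rewrite -!lee_fin /F fineK// measure_ge0 probability_le1.
Qed.

Let FNy : F @ -oo --> (0 : R).
Proof. exact/fine_cvg/(@cvg_cdfNy0 _ _ _ _ (idR : {RV (normal_prob mu sg) >-> R})). Qed.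

Let Fy : F @ +oo --> (1 : R).
Proof. exact/fine_cvg/(@cvg_cdfy1 _ _ _ _ (idR : {RV (normal_prob mu sg) >-> R})). Qed.

Let scale_peak : sg * normal_peak sg = normal_peak 1.
Proof.
rewrite /normal_peak expr1n mul1r -mulrnAr sqrtrM ?sqr_ge0// sqrtr_sqr gtr0_norm//.
by rewrite invfM mulrA divff ?mul1r// gt_eqF.
Qed.

(** After standardization [k] is the same for all means and variances, which keeps the final
    constant uniform over graphs. *)
Lemma normal_cdf_like : normal_like (normal_peak (1 : R))
  (fun u => fine (normal_prob mu sg `]-oo, (mu + sg * u)])).
Proof.
rewrite -/(fun u => F (mu + sg * u)); split.
- move=> u.
  have d1 : is_derive u 1 (fun u : R => mu + sg * u) sg.
    have := deriv_add (is_derive_cst mu u 1) (deriv_scale sg (is_derive_id u 1)).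
    by rewrite add0r mulr1.
  have := is_derive1_comp (g := fun u => mu + sg * u) (d_F (mu + sg * u)) d1.
  congr (is_derive _ _ _ _).
  rewrite normal_pdfE ?gt_eqF// mulrC mulrA scale_peak /gauss /normal_fun.
  congr (_ * expR _); rewrite addrC addKr -mulr_natl; field.
  by rewrite gt_eqF.
- by move=> u; exact: F01.
- move=> e e0.
  have [N [_ hN]] : \forall y \near -oo, F y <= e.
    by move/cvgr_le : FNy; apply.
  exists ((N - 1 - mu) / sg) => y yN; apply: hN.
  by move: yN; rewrite ler_pdivlMr//; lra.
- move=> e e0.
  have [N [_ hN]] : \forall y \near +oo, 1 - e <= F y.
    by move/cvgr_ge : Fy; apply; lra.
  exists ((N + 1 - mu) / sg) => y yN.
  have : 1 - e <= F (mu + sg * y).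
    by apply: hN; move: yN; rewrite ler_pdivrMr//; lra.
  lra.
Qed.

End NormalCdf.

Lemma normal_cdf_itv (R : realType) (mu var x : R) :
  (0 <= normal_cdf mu var x <= 1)%E.
Proof.
rewrite /normal_cdf; case: ifP => _; first by rewrite measure_ge0 probability_le1.
by rewrite measure_ge0 probability_le1.
Qed.

Lemma normal_cdf_fin_num (R : realType) (mu var x : R) :
  normal_cdf mu var x \is a fin_num.
Proof.
have /andP[h0 h1] := normal_cdf_itv mu var x.
by rewrite ge0_fin_numE// (le_lt_trans h1)// ltry.
Qed.

(** * Normal approximation for a fixed graph *)

Section GraphNormal.
Context (R : realType).

(** The first summand covers graphs with few darts, for which the trivial bound 1 is used;
    [Delta.+1] ensures a positive degree bound. *)
Definition graph_const (Delta : nat) : R :=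
  Num.sqrt (dart_threshold R Delta.+1) +
  crossing_const Delta.+1 (normal_peak (1 : R)).

Definition crossing_mean n (G : sgraph n) : R := avg (crossings R G).

Definition crossing_var n (G : sgraph n) : R :=
  avg (fun s => (crossings R G s - crossing_mean G) ^+ 2).

Lemma crossings_normal_cdf n (G : sgraph n) (m Delta : nat) (x : R) :
  (0 < m)%N -> (m <= num_edges G)%N -> (max_degree G <= Delta)%N ->
  `|avg (fun s => (crossings R G s <= x)%R%:R) -
    fine (normal_cdf (crossing_mean G) (crossing_var G) x)| <=
  graph_const Delta / Num.sqrt m%:R.
Proof.
move=> m0 mG deg; set mu := crossing_mean G; set var := crossing_var G.
have k0 : 0 < normal_peak (1 : R) by rewrite normal_peak_gt0.
have c0 : 0 <= crossing_const Delta.+1 (normal_peak (1 : R)).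
  have B0 : 0 <= stein_bound (normal_peak (1 : R)).
    by rewrite /stein_bound addr_ge0// divr_ge0 ?expR_ge0// ltW.
  rewrite /crossing_const; set d : R := Delta.+1%:R; have d0 : 0 <= d by [].
  have M2 (a b : R) : 0 <= a -> 0 <= b -> 0 <= a * b by exact: mulr_ge0.
  have A2 (a b : R) : 0 <= a -> 0 <= b -> 0 <= a + b by exact: addr_ge0.
  have N (i : nat) : 0 <= i%:R :> R by exact: ler0n.
  have d2 : 0 <= 90 * (3 * 64) * d ^+ 2.
    by apply: (M2 _ _ _ (exprn_ge0 2 d0)); apply: (M2 _ _ (N 90) (M2 _ _ (N 3) (N 64))).
  apply: (A2 _ _ (M2 _ _ (N 2) d2)); apply: (M2).
    by apply: (M2 _ _ _ d0); exact: (M2 _ _ (N 11) (N 100)).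
  apply: (A2); first exact: (M2 _ _ (M2 _ _ (N 110) d0) (A2 _ _ B0 (N 2))).
  apply: (M2 _ _ (N 32)); apply: (A2 _ _ _ d2); apply: (M2 _ _ (M2 _ _ (N 110) d0)).
  by apply: (A2 _ _ _ (N 1)); exact: (M2 _ _ (M2 _ _ (N 110) (N 100)) d0).
have sm0 : 0 < Num.sqrt m%:R :> R by rewrite sqrtr_gt0 ltr0n.
have mM : m%:R <= #|darts G|%:R :> R.
  by rewrite ler_nat (leq_trans mG)// num_edges_le.
have deg1 : (max_degree G <= Delta.+1)%N by apply: leq_trans deg _.
have s01 (a b : R) : 0 <= a <= 1 -> 0 <= b <= 1 -> `|a - b| <= 1.
  by move=> /andP[? ?] /andP[? ?]; rewrite ler_norml; lra.
(* Below the threshold [m] is small as well, so the right-hand side is at least 1. *)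
have [big|small] := leP (dart_threshold R Delta.+1) #|darts G|%:R; last first.
  apply: (@le_trans _ _ 1).
    apply: s01; last first.
      have /andP[h0 h1] := normal_cdf_itv mu var x.
      by rewrite fine_ge0//= -lee_fin fineK// normal_cdf_fin_num.
    rewrite avg_ge0//= -[leRHS](avg_cst (card_perm_gt0 n)).
    by apply: ler_avg => s; rewrite lern1 leq_b1.
  rewrite ler_pdivlMr// mul1r /graph_const ler_wpDr// ler_wsqrtr//.
  by rewrite (le_trans mM)// ltW.
have G0 : (0 < num_edges G)%N by apply: leq_trans mG.
have v0 : 0 < var.
  by have [] := crossings_normal x k0 (normal_cdf_like mu (@ltr01 R)) (ltn0Sn _) G0 deg1 big.
have sv0 : 0 < Num.sqrt var by rewrite sqrtr_gt0.
have e : mu + Num.sqrt var * ((x - mu) / Num.sqrt var) = x.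
  by rewrite mulrC divfK ?gt_eqF// addrC subrK.
have [_] := crossings_normal x k0 (normal_cdf_like mu sv0) (ltn0Sn _) G0 deg1 big.
rewrite -/crossing_mean -/mu -/(crossing_var G) -/var /= e.
rewrite /normal_cdf gt_eqF// => /le_trans; apply.
apply: ler_pM; rewrite ?invr_ge0//.
  by rewrite /graph_const lerDr sqrtr_ge0.
by rewrite lef_pV2 ?posrE// ?ler_wsqrtr// sqrtr_gt0 (lt_le_trans _ mM)// ltr0n.
Qed.

End GraphNormal.

(** * Mixtures *)

Section EsumFinite.
Local Open Scope ereal_scope.

(** One inequality comes from finite subsums; the same inequality for [c^-1] gives the converse. *)
Lemma esumZ (R : realType) (I : choiceType) (A : set I) (c : R) (a : I -> \bar R) :
  (0 <= c)%R -> (forall i, 0 <= a i) ->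
  \esum_(i in A) (a i * c%:E) = c%:E * \esum_(i in A) a i.
Proof.
have le (k : R) (b : I -> \bar R) : (0 <= k)%R -> (forall i, 0 <= b i) ->
    \esum_(i in A) (k%:E * b i) <= k%:E * \esum_(i in A) b i.
  move=> k0 b0; apply: ge_ereal_sup => _ [B hB <-].
  rewrite -ge0_mule_fsumr//; apply: lee_wpmul2l; first by rewrite lee_fin.
  by apply: ereal_sup_ubound; exists B.
move=> c0 a0; under eq_esum do rewrite muleC.
have [->|cn0] := eqVneq c 0%R.
  by rewrite mul0e esum1// => i _; rewrite mul0e.
have {}c0 : (0 < c)%R by rewrite lt_neqAle eq_sym cn0.
apply/eqP; rewrite eq_le le ?(ltW c0)//=.
have h := @le c^-1%R (fun i => c%:E * a i).
rewrite -[leRHS]mul1e -(divff cn0) EFinM -muleA; apply: lee_wpmul2l.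
  by rewrite lee_fin ltW.
apply: le_trans (h _ _); rewrite ?invr_ge0 ?(ltW c0)//.
  apply: le_esum => i _; rewrite muleA -EFinM mulVf// mul1e//.
by move=> i; rewrite mule_ge0// lee_fin ltW.
Qed.

Lemma esum_fiber (R : realType) (I : choiceType) (U : finType) (G : I -> U)
    (a : I -> \bar R) : (forall i, 0 <= a i) ->
  \esum_(i in [set: I]) a i =
  \sum_(u : U) \esum_(i in [set i | G i = u]) a i.
Proof.
move=> a0; transitivity (\esum_(i in [set: I]) \sum_(u : U) (if G i == u then a i else 0)).
  apply: eq_esum => i _; rewrite (bigD1 (G i))//= eqxx big1 ?adde0// => u.
  by rewrite eq_sym => /negbTE ->.
rewrite esum_sum; last by move=> i u _ _; case: ifP.
apply: eq_bigr => u _; rewrite [RHS]esum_mkcond; apply: eq_esum => i _.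
case: eqP => [e|ne]; first by rewrite mem_set.
by rewrite memNset.
Qed.

End EsumFinite.

(** * Joint law of the random graph and the permutation *)

Section JointLaw.
Context (R : realType) d (T : measurableType d) (P : probability T R).
Context (V U : finType) (gr : T -> V) (s : T -> U).
Hypotheses (gr_meas : discrete_rv gr) (s_meas : discrete_rv s).
Hypotheses (s_unif : uniform_rv P s) (indep : independent_rv P gr s).

Definition mass (v : V) : R := fine (P (gr @^-1` [set v])).

Lemma massE v : P (gr @^-1` [set v]) = (mass v)%:E.
Proof. by rewrite /mass fineK// fin_num_measure. Qed.

Lemma mass_ge0 v : 0 <= mass v.
Proof. by rewrite -lee_fin -massE. Qed.

(** Both variables take finitely many values, so the integrand is a finite combination of indicators
    of joint events. *)
Lemma integral_joint (k : V -> U -> R) :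
  (\int[P]_w (k (gr w) (s w))%:E = (\sum_v mass v * avg (k v))%:E)%E.
Proof.
pose B (q : V * U) := gr @^-1` [set q.1] `&` s @^-1` [set q.2].
have mB q : measurable (B q) by apply: measurableI; [exact: gr_meas|exact: s_meas].
transitivity (\int[P]_w (\sum_(q : V * U) (k q.1 q.2)%:E * (\1_(B q) w)%:E))%E.
  apply: eq_integral => w _; rewrite (bigD1 (gr w, s w))//= big1 ?adde0.
    by rewrite indicE mem_set// mule1.
  move=> [v u] /= ne; rewrite indicE memNset ?mule0// => -[/= e1 e2].
  by move: ne; rewrite e1 e2 eqxx.
rewrite integral_sum//; last by move=> q; apply: integrableZl => //; exact: integrable_indic.
transitivity (\sum_(q : V * U) (k q.1 q.2 * (mass q.1 / #|U|%:R))%:E)%E.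
  apply: eq_bigr => -[v u] _ /=; rewrite integralZl//; last exact: integrable_indic.
  by rewrite integral_indic// setIT /B /= indep s_unif massE -!EFinM.
rewrite sumEFin; congr (_%:E).
rewrite -(pair_bigA _ (fun v u => k v u * (mass v / #|U|%:R)))/=.
apply: eq_bigr => v _; rewrite /avg mulrCA mulr_suml.
by apply: eq_bigr => u _; ring.
Qed.

Lemma sum_mass : (0 < #|U|)%N -> \sum_v mass v = 1.
Proof.
move=> U0; have := integral_joint (fun _ _ => 1).
rewrite integral_cst// mul1e => h.
apply: EFin_inj; apply: etrans (@probability_setT _ _ _ P).
rewrite h; congr (_%:E).
by apply: eq_bigr => v _; rewrite avg_cst// mulr1.
Qed.

(** By independence, [s] remains uniform given [gr = v]. *)
Lemma cond_expectation_joint (X : T -> R) (h : U -> R) v : mass v != 0 ->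
  (forall w, gr w = v -> X w = h (s w)) ->
  cond_expectation P X (gr @^-1` [set v]) = avg h.
Proof.
move=> v0 Xh; rewrite /cond_expectation -/(mass v).
have -> : ('E_P[X \* \1_(gr @^-1` [set v])] = (mass v * avg h)%:E)%E.
  rewrite unlock (eq_integral (fun w => ((gr w == v)%:R * h (s w))%:E)).
    rewrite (integral_joint (fun u x => (u == v)%:R * h x)) (bigD1 v)//= big1 ?addr0.
      by congr (_ * _)%:E; apply: eq_avg => x; rewrite eqxx mul1r.
    move=> u /negbTE uv; rewrite (eq_avg (H := fun=> 0)).
      by rewrite /avg big1 ?mul0r ?mulr0.
    by move=> x; rewrite uv mul0r.
  move=> w _ /=; rewrite indicE; congr (_%:E); case: eqP => [e|ne].
    by rewrite mem_set// Xh// mulr1 mul1r.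
  by rewrite memNset// mulr0 mul0r.
by rewrite /= [mass v * avg h]mulrC mulfK.
Qed.

Lemma mixture_esum (I : choiceType) (G : I -> V) (p : I -> R) (N : V -> R) :
  (forall i, 0 <= p i) -> has_mixture_law P gr G p -> (forall v, 0 <= N v) ->
  (\esum_(i in [set: I]) ((p i)%:E * (N (G i))%:E) = (\sum_v mass v * N v)%:E)%E.
Proof.
move=> p0 law N0; rewrite (esum_fiber G); last by move=> i; rewrite mule_ge0// lee_fin.
rewrite -sumEFin; apply: eq_bigr => v _.
transitivity (\esum_(i in [set i | G i = v]) ((p i)%:E * (N v)%:E))%E.
  by apply: eq_esum => i /= ->.
rewrite esumZ//.
by rewrite -law massE -EFinM mulrC.
Qed.

(** Lets a graph of positive mass inherit the edge and degree bounds assumed for the family. *)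
Lemma mass_fiber (I : choiceType) (G : I -> V) (p : I -> R) v :
  has_mixture_law P gr G p -> mass v != 0 -> exists i, G i = v.
Proof.
move=> law; apply: contra_neqP => /forallNP h.
by rewrite /mass law esum1// => i /= /h.
Qed.

End JointLaw.

Theorem theorem1p2 (R : realType) (Delta : nat) :
  exists C : R,
  forall (n m : nat) (I : countType) (G : I -> sgraph n) (p : I -> R)
    (d : measure_display) (T : measurableType d) (P : probability T R)
    (gr : T -> sgraph n) (s : T -> {perm 'I_n}) (X : {RV P >-> R}),
  (forall i, 0 <= p i) ->
  (\esum_(i in [set: I]) (p i)%:E = 1)%E ->
  discrete_rv gr ->
  has_mixture_law P gr G p ->
  discrete_rv s ->
  uniform_rv P s ->
  independent_rv P gr s ->
  (forall w, X w = (num_crossings (gr w) (s w))%:R) ->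
  (1 <= m)%N ->
  (forall i, (m <= num_edges (G i))%N) ->
  (forall i, (max_degree (G i) <= Delta)%N) ->
  let mu i := cond_expectation P X (gr @^-1` [set G i]) in
  let var i := cond_variance P X (gr @^-1` [set G i]) in
  (kolmogorov_dist (cdf X)
     (fun x => \esum_(i in [set: I]) ((p i)%:E * normal_cdf (mu i) (var i) x))
   <= (C / Num.sqrt m%:R)%:E)%E.
Proof.
exists (graph_const R Delta).
move=> n m I G p d T P gr s X p0 p1 gr_meas law s_meas s_unif indep XE m1 mG dG /=.
apply: ge_ereal_sup => _ [x _ <-].
have U0 := card_perm_gt0 n.
pose cE v := cond_expectation P X (gr @^-1` [set v]).
pose cV v := cond_variance P X (gr @^-1` [set v]).
pose N v := fine (normal_cdf (cE v) (cV v) x).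
pose a (v : sgraph n) := avg (fun u => (crossings R v u <= x)%R%:R : R).
have N01 v : 0 <= N v.
  by apply: fine_ge0; have /andP[] := normal_cdf_itv (cE v) (cV v) x.
have -> : cdf X x = (\sum_v mass P gr v * a v)%:E.
  rewrite -(integral_joint gr_meas s_meas s_unif indep
    (fun v u => (crossings R v u <= x)%R%:R)).
  have mX : measurable (X @^-1` `]-oo, x]) by exact: measurable_funPTI.
  transitivity (\int[P]_w (\1_(X @^-1` `]-oo, x]) w)%:E)%E.
    by rewrite integral_indic// setIT.
  apply: eq_integral => w _.
  rewrite indicE /crossings -XE; congr ((nat_of_bool _)%:R%:E).
  by apply/idP/idP => [/set_mem|h]; rewrite /= ?in_itv//=; apply/mem_set; rewrite /= in_itv.
have -> : (\esum_(i in [set: I]) ((p i)%:E * normal_cdf (cE (G i)) (cV (G i)) x) =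
    (\sum_v mass P gr v * N v)%:E)%E.
  rewrite -(mixture_esum gr_meas p0 law N01); apply: eq_esum => i _.
  by rewrite /N fineK// normal_cdf_fin_num.
rewrite -EFinB abse_EFin lee_fin -sumrB.
apply: le_trans (ler_norm_sum _ _ _) _.
set c := graph_const R Delta / _.
(* The masses sum to 1, so the bound can be checked graph by graph. *)
rewrite -[c]mul1r -(sum_mass gr_meas s_meas s_unif indep U0) mulr_suml.
apply: ler_sum => v _; rewrite -mulrBr normrM ger0_norm ?mass_ge0//.
have [->|v0] := eqVneq (mass P gr v) 0; first by rewrite !mul0r.
rewrite ler_wpM2l ?mass_ge0//.
have [i Giv] := mass_fiber law v0.
have eE : cE v = crossing_mean R v.
  apply: (cond_expectation_joint gr_meas s_meas s_unif indep v0) => w grw.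
  by rewrite XE grw.
have eV : cV v = crossing_var R v.
  rewrite /cV /cond_variance -/(cE v) eE.
  apply: (cond_expectation_joint gr_meas s_meas s_unif indep v0) => w grw.
  by rewrite XE grw.
by rewrite /N /a eE eV; apply: crossings_normal_cdf; rewrite // -Giv.
Qed.
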